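(* Let $X$ be a separable real Banach space. Then $X$ admits an equivalent strictly convex norm $|||\cdot|||$ with the following properties. (a) If $(x_n)\subseteq X$ is relatively weakly compact and $$\lim_{m\to\infty}\lim_{n\to\infty}|||x_m+x_n||| = 2\lim_{n\to\infty}|||x_n|||,$$ then $(x_n)$ is norm convergent. (b) If $(x_n)\subseteq X$ satisfies $$\lim_{m\to\infty}\lim_{n\to\infty}|||x_m+ x_n||| =\lim_{m\to\infty}\lim_{n\to\infty}|||x_m- x_n||| = 2\lim_{n\to\infty}|||x_n|||>0,$$ then some subsequence of $(x_n)$ is equivalent to the unit vector basis of $\ell_1$. (c) If $(x_n)\subseteq X$ is weakly null and satisfies $$\lim_{m\to\infty}\lim_{n\to\infty}|||x_m+x_n||| = \lim_{n\to\infty}|||x_n|||>0,$$ then some subsequence of $(x_n)$ is equivalent to the unit vector basis of $c_0$.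
   Context: A norm $|||\cdot|||$ is strictly convex if $|||x|||=|||y|||=1$ and $|||x+y|||=2$ imply $x=y$. A sequence $(x_n)$ in a Banach space is equivalent to a basic sequence $(e_n)$ if there are constants $A,B>0$ with $A^{-1}\|\sum a_ix_i\|\le\|\sum a_ie_i\|\le B\|\sum a_ix_i\|$ for all finitely supported real $(a_i)$. A hypothesis stated as an equality of limits includes the assumption that all the limits (including the inner limits of iterated limits, for each value of the outer index) exist. *)

(* Defs.v *)
From HB Require Import structures.
From mathcomp Require Import all_boot all_order all_algebra.
From mathcomp Require Import all_classical all_reals all_analysis.

Set Implicit Arguments.
Unset Strict Implicit.
Unset Printing Implicit Defensive.

Import Order.TTheory GRing.Theory Num.Theory.
Import numFieldNormedType.Exports.

Local Open Scope classical_set_scope.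
Local Open Scope ring_scope.

Definition separable (T : topologicalType) : Prop :=
  exists2 D : set T, countable D & dense D.

(* The coarsest topology on the carrier of X making every norm-continuous linear
   functional continuous; as a type, weak X is convertible to X. *)
Definition weak (R : realType) (X : normedModType R) : topologicalType :=
  sup_topology (fun f : {f : {linear X -> R^o} | continuous f} =>
    Topological.on (initial_topology (projT1 f : X -> R^o))).

(* The set of terms of x has compact closure in the weak topology. *)
Definition relatively_weakly_compact (R : realType) (X : normedModType R)
    (x : nat -> X) : Prop :=
  precompact (range x : set (weak X)).

Definition weakly_null (R : realType) (X : normedModType R)
    (x : nat -> X) : Prop :=
  (x : nat -> weak X) @ \oo --> (0 : weak X).

(* Nonnegativity of N follows from these axioms. *)
Definition is_norm (R : realType) (V : lmodType R) (N : V -> R) : Prop :=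
  [/\ forall x, N x = 0 -> x = 0,
      forall (a : R) x, N (a *: x) = `|a| * N x
    & forall x y, N (x + y) <= N x + N y].

Definition equivalent_norm (R : realType) (X : normedModType R)
    (N : X -> R) : Prop :=
  is_norm N /\
  exists c C : R, [/\ 0 < c, 0 < C &
    forall x, c * `|x| <= N x <= C * `|x|].

Definition strictly_convex (R : realType) (V : lmodType R)
    (N : V -> R) : Prop :=
  forall x y, N x = 1 -> N y = 1 -> N (x + y) = 2 -> x = y.

(* lim_m lim_n f m n exists and equals l, where the inner limit is required to
   exist (in R) for every m. *)
Definition iterated_lim (R : realType) (f : nat -> nat -> R) (l : R) : Prop :=
  exists2 g : nat -> R,
    forall m, f m n @[n --> \oo] --> g m & g m @[m --> \oo] --> l.

(* Equivalence of (x_n) and (e_n), the ambient norms being passed explicitly.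
   A finitely supported (a_i) is given by an arbitrary sequence of which only
   the first n terms are used. *)
Definition equivalent_sequences (R : realType) (V W : lmodType R)
    (normV : V -> R) (normW : W -> R) (x : nat -> V) (e : nat -> W) : Prop :=
  exists A B : R, [/\ 0 < A, 0 < B &
    forall (n : nat) (a : nat -> R),
      A^-1 * normV (\sum_(i < n) a i *: x i)
        <= normW (\sum_(i < n) a i *: e i)
        <= B * normV (\sum_(i < n) a i *: x i)].

(* The norms of l_1 and c_0 are given on all real sequences; they are meaningful
   only on summable, respectively bounded, sequences, hence in particular on the
   linear span of the unit vectors. *)
Definition l1_norm (R : realType) (u : nat -> R^o) : R :=
  limn (series (fun k => `|u k|)).

Definition c0_norm (R : realType) (u : nat -> R^o) : R :=
  sup (range (fun k => `|u k|)).

Definition unit_vector (R : realType) (i : nat) : nat -> R^o :=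
  fun k => (k == i)%:R.

Definition equivalent_to_l1_basis (R : realType) (X : normedModType R)
    (x : nat -> X) : Prop :=
  equivalent_sequences (fun v : X => `|v|) (@l1_norm R) x (@unit_vector R).

Definition equivalent_to_c0_basis (R : realType) (X : normedModType R)
    (x : nat -> X) : Prop :=
  equivalent_sequences (fun v : X => `|v|) (@c0_norm R) x (@unit_vector R).

Definition has_subsequence (T : Type) (P : (nat -> T) -> Prop)
    (x : nat -> T) : Prop :=
  exists2 phi : nat -> nat, increasing_seq phi & P (x \o phi).

(* Main.v *)
(** For a dense sequence (d_k) with d_0 = 0, the norms
    |x|_k = | |x| d_k + x | + | |x| d_k - x | are added up with positive weights.
    An equality N (x + y) = N x + N y then splits into equalities for every |.|_k,
    and, since the points s d_k are dense in X for s > 0, an asymptotic form of it along a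
    sequence (x_n) becomes information on the functions y |-> lim |y + b x_n| for
    all y in X at once.  Limits are taken along an ultrafilter U, so that they exist:
    with p(y, b) = lim_n |y + b x_n| and
    P(y, a, b) = lim_m lim_n |y + a x_m + b x_n|, the hypotheses of the theorem give
    P(y, c, e c) + P(y, -c, -e c) = p(y, k c) + p(y, -k c) for c > 0, where
    k = 2 and e = 1 in (a), k = 2 and e = 1 or -1 in (b), k = e = 1 in (c).
    By convexity, P(y, a, b) = p(y, a + b) for a, b >= 0 in (a),
    P(y, a, b) >= min (p(y, |a| + |b|), p(y, -|a| - |b|)) in (b), and
    P(y, a, 1) <= p(y, 1) for 0 <= a <= 1 in (c).  These one-step estimates hold
    uniformly on compact sets up to a small error, so they can be chained along a
    subsequence: this bounds |sum a_i x_i| by the l_1 or c_0 norm of (a_i) in (b) and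
    (c), while in (a), with Mazur's theorem, it makes (x_n) Cauchy along U; strict
    convexity shows that the limit does not depend on U. *)

Require Import Defs.
From HB Require Import structures.
From mathcomp Require Import all_boot all_order all_algebra.
From mathcomp Require Import all_classical all_reals all_analysis.
From mathcomp Require Import ring lra.
Import Order.TTheory GRing.Theory Num.Theory.
Import numFieldNormedType.Exports.

Set Implicit Arguments.
Unset Strict Implicit.
Unset Printing Implicit Defensive.

Local Open Scope classical_set_scope.
Local Open Scope ring_scope.

(** * Sublinear functionals and the Hahn-Banach theorem under lower constraints *)

Section HahnBanach.
Context {R : realType} {V : lmodType R}.
Implicit Types (q : V -> R) (K : V -> R -> Prop).

Definition sublinear q := (forall x y, q (x + y) <= q x + q y) /\
  (forall t x, 0 <= t -> q (t *: x) = t * q x).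

Lemma sublinear0 q : sublinear q -> q 0 = 0.
Proof. by move=> [_ /(_ 0 0 (lexx _))]; rewrite scale0r mul0r. Qed.

Lemma sublinearN q x : sublinear q -> - q (- x) <= q x.
Proof.
by move=> sq; have := sq.1 x (- x); rewrite subrr (sublinear0 sq); lra.
Qed.

(** A pair with [K w c] stands for a constraint [c <= f w] on the functional sought; the constraints
    form a convex cone in the product of [V] with the reals. *)
Definition additive_cone K := [/\ K 0 0,
  forall w c w' c', K w c -> K w' c' -> K (w + w') (c + c') &
  forall t w c, 0 <= t -> K w c -> K (t *: w) (t * c)].

(** This infimal convolution absorbs the constraints into [q]: its value at [- w] is at most [- c],
    so a linear functional below it satisfies [c <= f w]. *)
Definition cone_inf q K v := inf [set r | exists w c, K w c /\ r = q (v + w) - c].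

Section cone.
Variables (q : V -> R) (K : V -> R -> Prop).
Hypotheses (sq : sublinear q) (cK : additive_cone K).
Hypothesis qK : forall w c, K w c -> c <= q w.

(** Writing [w] as [- v + (v + w)] bounds [q w], hence [c], and keeps the infimum in [cone_inf]
    finite. *)
Let lb v w c : K w c -> - q (- v) <= q (v + w) - c.
Proof. by move=> /qK; have := sq.1 (- v) (v + w); rewrite addKr; lra. Qed.

Lemma cone_inf_le v w c : K w c -> cone_inf q K v <= q (v + w) - c.
Proof.
move=> Kwc; apply: ge_inf; last by exists w, c.
by exists (- q (- v)) => _ [w' [c' [/lb + ->]]]; exact.
Qed.

Lemma le_cone_inf v m : (forall w c, K w c -> m <= q (v + w) - c) ->
  m <= cone_inf q K v.
Proof.
move=> mle; apply: lb_le_inf.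
  by exists (q (v + 0) - 0), 0, 0; split => //; case: cK.
by move=> _ [w [c [/mle + ->]]]; exact.
Qed.

Lemma cone_inf_id v : cone_inf q K v <= q v.
Proof. by have [K0 _ _] := cK; have := cone_inf_le v K0; rewrite addr0 subr0. Qed.

Let infZ t v : 0 < t -> t * cone_inf q K v <= cone_inf q K (t *: v).
Proof.
move=> t0; apply: le_cone_inf => w c Kwc.
have [_ _ KZ] := cK.
have ti : 0 <= t^-1 by rewrite invr_ge0 ltW.
have := cone_inf_le v (KZ _ _ _ ti Kwc).
rewrite -(ler_pM2l t0) => /le_trans; apply.
rewrite mulrBr mulrA mulfV ?gt_eqF// mul1r -sq.2 ?(ltW t0)//.
by rewrite scalerDr scalerA mulfV ?gt_eqF// scale1r.
Qed.

Lemma sublinear_cone_inf : sublinear (cone_inf q K).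
Proof.
have [K0 KD KZ] := cK; split=> [x y|t x].
  rewrite -lerBlDr; apply: le_cone_inf => w c Kwc.
  rewrite lerBlDl -lerBlDr; apply: le_cone_inf => w' c' Kwc'.
  have := cone_inf_le (x + y) (KD _ _ _ _ Kwc Kwc').
  have := sq.1 (x + w) (y + w').
  by rewrite addrACA; lra.
rewrite le_eqVlt => /orP[/eqP<-|t0].
  rewrite scale0r mul0r; apply/eqP; rewrite eq_le; apply/andP; split.
    by have := cone_inf_le 0 K0; rewrite addr0 subr0 (sublinear0 sq).
  by apply: le_cone_inf => w c /qK; rewrite add0r subr_ge0.
apply/eqP; rewrite eq_le infZ// andbT.
have ti : 0 < t^-1 by rewrite invr_gt0.
have := infZ (t *: x) ti.
rewrite scalerA mulVf ?gt_eqF// scale1r -(ler_pM2l t0) mulrA mulfV ?gt_eqF//.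
by rewrite mul1r.
Qed.

End cone.

(* A minimal sublinear functional is linear: adjoining the ray of (y, q y) to it
   by [cone_inf] does not decrease it. *)
Lemma minimal_sublinear_linear q : sublinear q ->
  (forall p, sublinear p -> (forall x, p x <= q x) -> p = q) ->
  exists f : {linear V -> R^o}, q = f.
Proof.
move=> sq qmin.
have qD x y : q (x + y) = q x + q y.
  apply/eqP; rewrite eq_le sq.1/=.
  pose K w c := exists2 t, 0 <= t & w = t *: y /\ c = t * q y.
  have cK : additive_cone K.
    split; first by exists 0 => //; rewrite scale0r mul0r.
      move=> w c w' c' [t t0 [-> ->]] [t' t0' [-> ->]].
      by exists (t + t'); [exact: addr_ge0|rewrite scalerDl mulrDl].
    move=> s w c s0 [t t0 [-> ->]].
    by exists (s * t); [exact: mulr_ge0|rewrite scalerA mulrA].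
  have qK w c : K w c -> c <= q w by move=> [t t0 [-> ->]]; rewrite sq.2.
  have <- : cone_inf q K x = q x.
    rewrite (qmin (cone_inf q K))//; first exact: sublinear_cone_inf.
    by move=> v; exact: cone_inf_id.
  have /(cone_inf_le sq qK x) : K y (q y).
    by exists 1 => //; rewrite scale1r mul1r.
  lra.
have qN x : q (- x) = - q x.
  by apply/eqP; rewrite -addr_eq0 -qD addNr (sublinear0 sq).
have qZ (a : R) (x : V) : q (a *: x) = a * q x.
  have [a0|/ltW a0] := leP 0 a; first by rewrite sq.2.
  have := sq.2 (- a) x; rewrite oppr_ge0 scaleNr qN mulNr => /(_ a0).
  exact: oppr_inj.
have qL : linear (q : V -> R^o) by move=> a x y; rewrite qD qZ.
pose qL' := GRing.isLinear.Build _ _ _ _ (q : V -> R^o) qL.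
pose f : {linear V -> R^o} := HB.pack (q : V -> R^o) qL'.
by exists f.
Qed.

(** Supplies the lower bounds needed for Zorn's lemma. The pointwise infimum of the chain is finite
    since each member is comparable with [q], and subadditive since of two members the smaller one
    can be used at both points. *)
Lemma sublinear_chain_inf (A : set (V -> R)) q : A q ->
  (forall p, A p -> sublinear p) ->
  (forall p p', A p -> A p' ->
    (forall x, p x <= p' x) \/ (forall x, p' x <= p x)) ->
  exists2 m, sublinear m & forall p, A p -> forall x, m x <= p x.
Proof.
move=> Aq sA totA.
have lb p x : A p -> - q (- x) <= p x.
  move=> Ap; have [pq|qp] := totA _ _ Ap Aq.
    by have := sublinearN x (sA _ Ap); have := pq (- x); lra.
  by have := sublinearN x (sA _ Aq); have := qp x; lra.
pose m x := inf [set r | exists2 p, A p & r = p x].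
have mle p x : A p -> m x <= p x.
  move=> Ap; apply: ge_inf; last by exists p.
  by exists (- q (- x)) => _ [p' Ap' ->]; exact: lb.
have lem c x : (forall p, A p -> c <= p x) -> c <= m x.
  move=> H; apply: lb_le_inf; first by exists (q x), q.
  by move=> _ [p Ap ->]; exact: H.
exists m; last by move=> p Ap x; exact: mle.
split=> [x y|t x].
  rewrite -lerBlDr; apply: (lem _ _) => p Ap.
  rewrite lerBlDl -lerBlDr; apply: (lem _ _) => p' Ap'.
  have [pp'|p'p] := totA _ _ Ap Ap'.
    by have := mle _ (x + y) Ap; have := (sA _ Ap).1 x y; have := pp' y; lra.
  by have := mle _ (x + y) Ap'; have := (sA _ Ap').1 x y; have := p'p x; lra.
rewrite le_eqVlt => /orP[/eqP<-|t0].
  rewrite scale0r mul0r; apply/eqP; rewrite eq_le; apply/andP; split.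
    by rewrite -(sublinear0 (sA _ Aq)); exact: mle.
  by apply: (lem _ _) => p Ap; rewrite (sublinear0 (sA _ Ap)).
apply/eqP; rewrite eq_le; apply/andP; split.
  rewrite mulrC -ler_pdivrMr//; apply: (lem _ _) => p Ap.
  rewrite ler_pdivrMr// mulrC -(sA _ Ap).2 ?(ltW t0)//; exact: mle.
by apply: (lem _ _) => p Ap; rewrite (sA _ Ap).2 ?(ltW t0)// ler_pM2l//; exact: mle.
Qed.

(** A minimal sublinear functional below [cone_inf q K] exists by Zorn's lemma and is linear; its
    values at the points [- w] give the constraints. *)
Lemma hahn_banach q K : sublinear q -> additive_cone K ->
  (forall w c, K w c -> c <= q w) ->
  exists f : {linear V -> R^o},
    (forall x, f x <= q x) /\ (forall w c, K w c -> c <= f w).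
Proof.
move=> sq cK qK; pose q' := cone_inf q K.
have sq' : sublinear q' by exact: sublinear_cone_inf.
pose P p := sublinear p /\ forall x, p x <= q' x; pose T := {p | P p}.
(* The order is reversed, so that a maximal element for [r] is a minimal functional. *)
pose r (s t : T) : bool := `[< forall x, projT1 t x <= projT1 s x >].
have [||||[p [sp pq']] pmin] := @Zorn T r.
- by move=> t; apply/asboolP.
- move=> t s u /asboolP H /asboolP H'; apply/asboolP => x.
  by apply: (le_trans (H' x)).
- move=> [s ?] [t ?] /asboolP/= H /asboolP/= H'; apply: eq_exist => /=.
  by apply/funext => x; apply/eqP; rewrite eq_le H' H.
- move=> A totA; have [[s As]|A0] := pselect (exists s, A s); last first.
    have Pq' : P q' by split.
    by exists (exist P _ Pq') => s As; exfalso; apply: A0; exists s.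
  have [|||m sm mle] := @sublinear_chain_inf [set projT1 t | t in A] (projT1 s).
  + by exists s.
  + by move=> _ [t _ <-]; case: t => ? [].
  + move=> _ _ [t At <-] [u Au <-].
    by have [/asboolP H|/asboolP H] := totA _ _ At Au; [right|left].
  have Pm : P m.
    split=> // x; apply: le_trans (_ : projT1 s x <= _); first by apply: mle; exists s.
    by case: (s) => ? [].
  by exists (exist P _ Pm) => t At; apply/asboolP => x /=; apply: mle; exists t.
have [f pf] : exists f : {linear V -> R^o}, p = f.
  apply: minimal_sublinear_linear => // p' sp' p'p.
  have Pp' : P p'.
    by split=> // x; exact: le_trans (pq' x).
  by have [] := pmin (exist P _ Pp') (introT (asboolP _) p'p).
exists f; rewrite -pf; split=> [x|w c Kwc].
  exact: le_trans (pq' _) (cone_inf_id sq cK qK x).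
have := cone_inf_le sq qK (- w) Kwc; rewrite addNr (sublinear0 sq) -/q'.
have := pq' (- w); have -> : p (- w) = - p w by rewrite pf linearN.
lra.
Qed.

End HahnBanach.

(** * Mazur's theorem and weak lower semicontinuity *)

Section Mazur.
Context {R : realType} {X : normedModType R}.
Implicit Types (Z : set X) (h : X -> R).

Definition segment_closed Z := forall x y t, Z x -> Z y -> 0 <= t <= 1 ->
  Z (t *: x + (1 - t) *: y).

Definition convex_functional h := forall x y t, 0 <= t <= 1 ->
  h (t *: x + (1 - t) *: y) <= t * h x + (1 - t) * h y.

Lemma lipschitz_cvg (T : Type) (F : set_system T) (V W : normedModType R)
    (h : V -> W) C (x : T -> V) y : Filter F ->
  (forall u v, `|h u - h v| <= C * `|u - v|) ->
  x @ F --> y -> h (x t) @[t --> F] --> h y.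
Proof.
move=> FF hC xy.
have C0 : 0 < `|C| + 1 by rewrite ltr_wpDl.
apply/cvgrPdist_lt => e e0; near=> t; apply: (le_lt_trans (hC _ _)).
apply: (@le_lt_trans _ _ ((`|C| + 1) * `|y - x t|)).
  by apply: ler_wpM2r => //; rewrite (le_trans (ler_norm C))// lerDl.
rewrite mulrC -ltr_pdivlMr//.
by near: t; apply: cvgr_dist_lt => //; rewrite divr_gt0.
Unshelve. all: by end_near. Qed.

Lemma le_norm_continuous (f : {linear X -> R^o}) :
  (forall x, f x <= `|x|) -> continuous f.
Proof.
move=> fle y; apply: (@lipschitz_cvg _ _ X R^o f 1 id) => // u v.
rewrite mul1r -linearB ler_norml fle andbT.
by have := fle (- (u - v)); rewrite normrN linearN /=; lra.
Qed.

(** Hahn-Banach applied to the norm and the cone generated by the pairs [(z, c)] with [z] in [Z];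
    convexity of [Z] makes its positive multiples closed under sums. *)
Lemma norm_separation Z c : segment_closed Z -> (forall z, Z z -> c <= `|z|) ->
  exists f : {linear X -> R^o},
    (forall x, f x <= `|x|) /\ (forall z, Z z -> c <= f z).
Proof.
move=> cZ Zc.
pose K (w : X) (d : R) := (w = 0 /\ d = 0) \/
  exists t z, [/\ 0 < t, Z z, w = t *: z & d = t * c].
have [|||f [fle fK]] := @hahn_banach _ X (fun x => `|x|) K.
- by split=> [x y|t x t0]; rewrite ?ler_normD// normrZ ger0_norm.
- split; first by left.
    move=> w d w' d' [[-> ->]|[t [z [t0 Zz -> ->]]]]; first by rewrite !add0r.
    move=> [[-> ->]|[t' [z' [t'0 Zz' -> ->]]]].
      by rewrite !addr0; right; exists t, z.
    right; exists (t + t'), ((t / (t + t')) *: z + (1 - t / (t + t')) *: z').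
    have tt0 : 0 < t + t' by exact: addr_gt0.
    split=> //.
    + apply: cZ => //; rewrite divr_ge0 ?(ltW t0) ?(ltW tt0)//=.
      by rewrite ler_pdivrMr// mul1r lerDl ltW.
    + rewrite scalerDr !scalerA mulrBr mulr1 mulrCA mulfV ?gt_eqF// mulr1.
      by rewrite addrAC subrr add0r.
    + by rewrite mulrDl.
  move=> t w d; rewrite le_eqVlt => /orP[/eqP<-|t0].
    by rewrite scale0r mul0r => _; left.
  move=> [[-> ->]|[s [z [s0 Zz -> ->]]]]; first by rewrite scaler0 mulr0; left.
  by right; exists (t * s), z; split; rewrite ?mulr_gt0// ?scalerA ?mulrA.
- move=> w d [[-> ->]|[t [z [t0 Zz -> ->]]]]; first by rewrite normr0.
  by rewrite normrZ gtr0_norm// ler_pM2l// Zc.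
exists f; split=> // z Zz; apply: fK; right; exists 1, z.
by rewrite scale1r mul1r; split.
Qed.

(** Testing [y] against one functional at a time suffices for convex [Z]: if no point of [Z] were
    within [e] of [y], a functional of norm at most 1 would be at least [e] on all of [Z - y]. *)
Lemma mazur Z y : segment_closed Z ->
  (forall f : {linear X -> R^o}, continuous f ->
    forall e, 0 < e -> exists2 z, Z z & f z < f y + e) ->
  forall e, 0 < e -> exists2 z, Z z & `|z - y| < e.
Proof.
move=> cZ wZ e e0; apply: contrapT => nZ.
have [||f [fle fZ]] := @norm_separation [set z - y | z in Z] e.
- move=> _ _ t [z Zz <-] [z' Zz' <-] t01; exists (t *: z + (1 - t) *: z').
    exact: cZ.
  rewrite !scalerBr addrACA -opprD -scalerDl (_ : t + (1 - t) = 1) ?scale1r//.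
  by ring.
- move=> _ [z Zz <-]; rewrite leNgt; apply/negP => zy; apply: nZ.
  by exists z.
have [z Zz] := wZ f (le_norm_continuous fle) _ e0.
have := fZ (z - y) (ex_intro2 _ _ z Zz erefl).
by rewrite linearB /=; lra.
Qed.

Lemma weak_cvg (T : Type) (F : set_system T) (x : T -> X) (y : X)
    (f : {linear X -> R^o}) : Filter F -> continuous f ->
  (x : T -> weak X) @ F --> (y : weak X) -> f (x t) @[t --> F] --> f y.
Proof.
move=> FF cf xy.
have /cvg_sup/(_ (exist _ f cf)) : (fmap x F : set_system X) -->
  (y : sup_topology (fun f : {f : {linear X -> R^o} | continuous f} =>
    Topological.on (initial_topology (projT1 f : X -> R^o)))) by exact: xy.
move=> H; apply: (@cvg_comp _ _ _ (x : T -> initial_topology (f : X -> R^o)) f).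
  exact: H.
exact: (@initial_continuous X R^o f).
Qed.

(** Otherwise a sublevel set of [h] strictly below [h y] is convex and contains [x t] for almost all
    [t], so by Mazur's theorem it has points arbitrarily near [y], against the Lipschitz bound. *)
Lemma weak_lsc (T : Type) (F : set_system T) (x : T -> X) (y : X) h C l :
  ProperFilter F -> convex_functional h -> 0 < C ->
  (forall u v, `|h u - h v| <= C * `|u - v|) ->
  (x : T -> weak X) @ F --> (y : weak X) ->
  h (x t) @[t --> F] --> l -> h y <= l.
Proof.
move=> FF ch C0 hC xy hl; rewrite leNgt; apply/negP => lh.
pose e := (h y - l) / 2.
have e0 : 0 < e by rewrite divr_gt0 ?subr_gt0.
have [|||z zZ zy] := @mazur [set z | h z <= h y - e] y _ _ (e / C).
- move=> u v t /= hu hv t01; apply: (le_trans (ch _ _ _ t01)).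
  move/andP: t01 => [t0 t1].
  have -> : h y - e = t * (h y - e) + (1 - t) * (h y - e) by ring.
  by apply: lerD; apply: ler_wpM2l => //; rewrite subr_ge0.
- move=> f cf d d0; have fxy := weak_cvg FF cf xy.
  have : \forall t \near F, h (x t) <= h y - e /\ f (x t) < f y + d.
    near=> t; split.
      have : h (x t) < h y - e by near: t; apply: (cvgr_lt l) => //; rewrite /e; lra.
      exact: ltW.
    by near: t; apply: (cvgr_lt (f y)) => //; rewrite ltrDl.
  by move=> /filter_ex[t [? ?]]; exists (x t).
- exact: divr_gt0.
have := hC z y; have := zZ; rewrite /= ler_norml.
have : C * `|z - y| < e by rewrite mulrC -ltr_pdivlMr.
lra.
Unshelve. all: by end_near. Qed.

End Mazur.

(** * The equivalent norm as a weighted sum of seminorms *)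

Section Renorming.
Context {R : realType} {X : normedModType R}.
Implicit Types (p x y : X) (r : nat -> X -> R).

Definition seminorm (rho : X -> R) := (forall a x, rho (a *: x) = `|a| * rho x) /\
  (forall x y, rho (x + y) <= rho x + rho y).

Lemma seminormN rho x : seminorm rho -> rho (- x) = rho x.
Proof. by move=> sr; rewrite -scaleN1r sr.1 normrN1 mul1r. Qed.

Lemma seminorm_ge0 rho x : seminorm rho -> 0 <= rho x.
Proof.
move=> sr; have := sr.2 x (- x); rewrite subrr (seminormN _ sr) -(scale0r 0) sr.1.
by rewrite normr0 mul0r; lra.
Qed.

Definition two_norm p x := `| `|x| *: p + x| + `| `|x| *: p - x|.

(** As a function of the scalar the sum is even and convex, hence nondecreasing on nonnegative
    scalars. *)
Lemma two_norm_mono p x (s t : R) : 0 <= s <= t ->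
  `|s *: p + x| + `|s *: p - x| <= `|t *: p + x| + `|t *: p - x|.
Proof.
move=> /andP[s0 st]; have [t0|t0] := eqVneq t 0.
  by have -> : s = t by apply/eqP; rewrite eq_le st t0.
have {}t0 : 0 < t by rewrite lt_neqAle eq_sym t0 (le_trans s0).
pose l := s / t.
have l0 : 0 <= l by rewrite divr_ge0// ltW.
have l1 : l <= 1 by rewrite ler_pdivrMr// mul1r.
have lt : l * t = s by rewrite mulfVK// gt_eqF.
(* [s *: p + z] is a combination of [t *: p + z] and [t *: p - z] whose coefficients have absolute
   values summing to 1. *)
have key z : `|s *: p + z| <=
    (1 + l) / 2 * `|t *: p + z| + (1 - l) / 2 * `|t *: p - z|.
  have -> : s *: p + z =
      ((1 + l) / 2) *: (t *: p + z) - ((1 - l) / 2) *: (t *: p - z).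
    rewrite scalerBr scalerDr opprB [_ *: z - _]addrC addrACA -scalerBl.
    rewrite -scalerDl scalerA (_ : (_ - _) * t = s); last by rewrite -lt; field.
    by rewrite (_ : _ + _ = 1) ?scale1r//; field.
  apply: (le_trans (ler_normB _ _)); rewrite !normrZ.
  have l0' : 0 <= 1 + l by lra.
  have l1' : 0 <= 1 - l by lra.
  by rewrite (ger0_norm l0') (ger0_norm l1') gtr0_norm.
have := key x; have := key (- x); rewrite opprK; lra.
Qed.

(** For the triangle inequality the scalar |x + y| is first enlarged to |x| + |y| by
    [two_norm_mono], after which both terms split. *)
Lemma seminorm_two_norm p : seminorm (two_norm p).
Proof.
have hN x : two_norm p (- x) = two_norm p x.
  by rewrite /two_norm normrN opprK addrC.
have hZ (a : R) x : 0 <= a -> two_norm p (a *: x) = a * two_norm p x.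
  move=> a0; rewrite /two_norm normrZ (ger0_norm a0) -!scalerA -scalerDr -scalerBr.
  by rewrite !(normrZ a) (ger0_norm a0) mulrDr.
split=> [a x|x y].
  have [a0|/ltW a0] := leP 0 a; first by rewrite hZ// ger0_norm.
  by rewrite -hN -scaleNr hZ ?oppr_ge0// ler0_norm.
have /(two_norm_mono p (x + y)) H : 0 <= `|x + y| <= `|x| + `|y|.
  by rewrite normr_ge0 ler_normD.
apply: (le_trans H); rewrite /two_norm scalerDl addrACA.
rewrite [X in _ + X <= _](_ : _ = `| `|x| *: p - x + (`|y| *: p - y)|); last first.
  by rewrite opprD addrACA.
have := ler_normD (`|x| *: p + x) (`|y| *: p + y).
have := ler_normD (`|x| *: p - x) (`|y| *: p - y).
lra.
Qed.

Lemma two_norm_le p x : two_norm p x <= 2 * (1 + `|p|) * `|x|.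
Proof.
have := ler_normD (`|x| *: p) x; have := ler_normB (`|x| *: p) x.
by rewrite /two_norm normrZ normr_id; lra.
Qed.

Lemma two_norm0 x : two_norm 0 x = 2 * `|x|.
Proof. by rewrite /two_norm scaler0 add0r sub0r normrN; ring. Qed.

Definition weighted_sum r x := limn (series (fun i => 2^-1 ^+ i.+1 * r i x)).

Section weighted_sum.
Variables (r : nat -> X -> R) (C : R).
Hypotheses (sr : forall i, seminorm (r i)) (rC : forall i x, r i x <= C * `|x|).

Let w0 i : 0 < 2^-1 ^+ i.+1 :> R.
Proof. by rewrite exprn_gt0. Qed.

Lemma partial_weighted_sum_le n x :
  series (fun i => 2^-1 ^+ i.+1 * r i x) n <= C * `|x|.
Proof.
have Cx : 0 <= C * `|x| by rewrite (le_trans _ (rC 0 x))// seminorm_ge0.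
(* [1 - 2^-1 ^+ n] is the sum of the first [n] weights; this sharper bound is the one that passes
   through the induction. *)
apply: (@le_trans _ _ ((1 - 2^-1 ^+ n) * (C * `|x|))); last first.
  by rewrite -[leRHS]mul1r ler_wpM2r// lerBlDr lerDl exprn_ge0.
rewrite seriesEord /=; elim: n => [|n IH].
  by rewrite big_ord0 expr0 subrr mul0r.
rewrite big_ord_recr /=.
have := ler_wpM2l (ltW (w0 n)) (rC n x); rewrite exprS; move: IH; lra.
Qed.

Lemma cvg_weighted_sum x :
  series (fun i => 2^-1 ^+ i.+1 * r i x) @ \oo --> weighted_sum r x.
Proof.
apply: nondecreasing_is_cvgn.
  apply/nondecreasing_seqP => n; rewrite !seriesEord /= big_ord_recr /= lerDl.
  by rewrite mulr_ge0// ?(ltW (w0 n))// seminorm_ge0.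
by exists (C * `|x|) => _ [n _ <-]; exact: partial_weighted_sum_le.
Qed.

Lemma weighted_sum_le x : weighted_sum r x <= C * `|x|.
Proof.
apply: limr_le; first exact: cvgP (@cvg_weighted_sum x).
by near=> n; exact: partial_weighted_sum_le.
Unshelve. all: by end_near. Qed.

Lemma seminorm_weighted_sum : seminorm (weighted_sum r).
Proof.
split=> [a x|x y].
  rewrite {1}/weighted_sum; apply: cvg_lim => //.
  apply: cvg_trans (cvgM (cvg_cst `|a|) (@cvg_weighted_sum x)); apply: near_eq_cvg; near=> n.
  rewrite ?fctE !seriesEord /= mulr_sumr; apply: eq_bigr => i _.
  by rewrite (sr i).1 mulrCA.
apply: ler_cvg_to (@cvg_weighted_sum (x + y))
  (cvgD (@cvg_weighted_sum x) (@cvg_weighted_sum y)) _.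
near=> n; rewrite ?fctE !seriesEord /= -big_split /=; apply: ler_sum => i _.
by rewrite -mulrDr ler_pM2l// (sr i).2.
Unshelve. all: by end_near. Qed.

End weighted_sum.

(** The remainder is a seminorm because it is again a weighted sum, with [r k] replaced by zero.
    This is what lets an equality for the whole norm descend to each [two_norm (d k)]. *)
Lemma weighted_sum_split r C k : (forall i, seminorm (r i)) ->
  (forall i x, r i x <= C * `|x|) ->
  exists2 tau, seminorm tau &
    forall x, weighted_sum r x = 2^-1 ^+ k.+1 * r k x + tau x.
Proof.
move=> sr rC; pose r' i x := if i == k then 0 else r i x.
have sr' i : seminorm (r' i).
  rewrite /r'; case: eqP => // _; split=> *; by rewrite ?mulr0 ?addr0.
have r'C i x : r' i x <= C * `|x|.
  rewrite /r'; case: eqP => // _; apply: le_trans (rC i x); exact: seminorm_ge0.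
exists (weighted_sum r'); first exact: seminorm_weighted_sum sr' r'C.
move=> x; rewrite {1}/weighted_sum; apply: cvg_lim => //.
apply: cvg_trans (cvgD (cvg_cst (2^-1 ^+ k.+1 * r k x))
  (cvg_weighted_sum sr' r'C (x:=x))); apply: near_eq_cvg; near=> n.
have kn : (k < n)%N by near: n; exists k.+1.
rewrite ?fctE !seriesEord /= (bigD1 (Ordinal kn))//= [in RHS](bigD1 (Ordinal kn))//=.
rewrite /r' eqxx mulr0 add0r; congr (_ + _); apply: eq_bigr => i ik.
by rewrite -val_eqE /= in ik; rewrite (negbTE ik).
Unshelve. all: by end_near. Qed.

(** Index 0 is reserved for the vector 0, since [two_norm 0] is twice the original norm: this gives
    the lower bound on the new norm and makes the original norm one of the summands. *)
Lemma separable_dense_seq : separable X ->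
  exists2 d : nat -> X, d 0 = 0 & forall y e, 0 < e -> exists k, `|d k - y| < e.
Proof.
move=> [D cD dD].
have [f fD] : exists f : nat -> X, forall y, D y -> exists k, f k = y.
  move: cD => /pcard_surjP[f fs]; exists f => y /fs[k _ <-]; by exists k.
exists (fun k => if k is k'.+1 then f k' else 0) => // y e e0.
have [|z [/= yz /fD[k fk]]] := dD (ball y e) _ (ball_open _ _).
  by exists y; exact: ballxx.
by exists k.+1; rewrite fk; move: yz; rewrite -ball_normE /= distrC.
Qed.

Lemma exists_renorming : separable X ->
  exists (d : nat -> X) (N : X -> R), [/\ d 0 = 0,
    forall y e, 0 < e -> exists k, `|d k - y| < e,
    is_norm N, forall x, `|x| <= N x <= 2 * `|x| &
    forall k, exists c tau, [/\ 0 < c, seminorm tau &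
      forall x, N x = c * two_norm (d k) x + tau x]].
Proof.
move=> /separable_dense_seq[d d0 dd].
(* Dividing by [1 + |d i|] makes every [r i] at most twice the norm. The term of index 0 in the
   weighted sum is then the norm itself, which gives the lower bound on the sum. *)
pose r i x := (1 + `|d i|)^-1 * two_norm (d i) x.
have g0 i : 0 < 1 + `|d i| by rewrite ltr_wpDr.
have sr i : seminorm (r i).
  have [h t] := seminorm_two_norm (d i); split=> [a x|x y]; rewrite /r.
    by rewrite h mulrCA.
  by rewrite -mulrDr ler_pM2l// invr_gt0.
have rC i x : r i x <= 2 * `|x|.
  rewrite /r mulrC ler_pdivrMr//; have := two_norm_le (d i) x; lra.
have sN := seminorm_weighted_sum sr rC.
have Nge x : `|x| <= weighted_sum r x.
  have [tau st ->] := weighted_sum_split 0 sr rC.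
  rewrite /r d0 normr0 addr0 invr1 mul1r two_norm0 expr1 mulrA mulVf// mul1r.
  by rewrite lerDl seminorm_ge0.
exists d, (weighted_sum r); split=> //.
- split; [|exact: sN.1|exact: sN.2] => x Nx0; apply/normr0_eq0/eqP.
  by rewrite eq_le normr_ge0 andbT -Nx0.
- by move=> x; rewrite Nge weighted_sum_le.
move=> k; have [tau st Nt] := weighted_sum_split k sr rC.
exists (2^-1 ^+ k.+1 * (1 + `|d k|)^-1), tau; split=> //.
by move=> x; rewrite Nt mulrA.
Qed.

End Renorming.

(** * Chaining one-step estimates *)

Section Telescoping.
Context {R : realType}.

(** Passing from [g i] to [g i.+1] spends the amount [c i] of the second argument. The bound 1 on
    the total keeps every intermediate argument in [[0, 1]], where the step is assumed. *)
Lemma telescoping_lower_bound (g : nat -> R -> R) (c eps : nat -> R) k n b :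
  (k <= n)%N -> (forall i, (k <= i < n)%N -> 0 <= c i) -> 0 <= b ->
  \sum_(k <= i < n) c i + b <= 1 ->
  (forall i t, (k <= i < n)%N -> 0 <= t <= 1 ->
    g i (c i + t) - eps i <= g i.+1 t) ->
  g k (\sum_(k <= i < n) c i + b) - \sum_(k <= i < n) eps i <= g n b.
Proof.
move=> kn; rewrite -(subnKC kn); move: (n - k)%N => j {n kn}.
elim: j b => [|j IH] b c0 b0 cb1 step.
  by rewrite addn0 !big_geq// add0r subr0.
rewrite addnS in c0 cb1 step *; rewrite !big_nat_recr/= ?leq_addr// in cb1 *.
have kj : (k <= k + j < (k + j).+1)%N by rewrite leq_addr ltnSn.
have lift i : (k <= i < k + j)%N -> (k <= i < (k + j).+1)%N.
  by move=> /andP[-> /ltnW].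
have cj := c0 _ kj.
have s0 : 0 <= \sum_(k <= i < k + j) c i.
  by rewrite big_nat_cond sumr_ge0// => i /andP[/lift/c0].
have b1 : 0 <= b <= 1 by lra.
have /IH IHb : forall i, (k <= i < k + j)%N -> 0 <= c i by move=> i /lift/c0.
have cb0 : 0 <= c (k + j)%N + b by lra.
have := IHb _ cb0; rewrite addrA => /(_ cb1)/(_ (fun i t h => step i t (lift i h))).
by have := step _ _ kj b1; lra.
Qed.

Lemma sum_half_powers_le (e : R) k n : 0 <= e ->
  \sum_(k <= i < n) e * 2^-1 ^+ i.+1 <= e.
Proof.
move=> e0; apply: (@le_trans _ _ (\sum_(0 <= i < n) e * 2^-1 ^+ i.+1)).
  have h i : 0 <= e * 2^-1 ^+ i.+1 by rewrite mulr_ge0// exprn_ge0.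
  have [kn|kn] := leqP k n; last by rewrite big_geq ?sumr_ge0// ltnW.
  by rewrite [leRHS](big_cat_nat _ kn)//= lerDr sumr_ge0.
have -> : \sum_(0 <= i < n) e * 2^-1 ^+ i.+1 = e * (1 - 2^-1 ^+ n).
  elim: n => [|n IH]; first by rewrite big_geq// expr0 subrr mulr0.
  by rewrite big_nat_recr//= IH exprS; field.
by rewrite -[leRHS]mulr1 ler_wpM2l// lerBlDr lerDl exprn_ge0.
Qed.

End Telescoping.

(** * Selecting a subsequence along which one-step estimates hold uniformly *)

Section Selection.
Context {R : realType} {X : normedModType R} (x : nat -> X).
(** Compactness of this set of combinations of the terms chosen so far lets a single next index
    serve all of them. *)
Fixpoint span_ball (s : seq nat) : set X := if s is m :: s' then
  (fun va => va.1 + va.2 *: x m) @` (span_ball s' `*` `[-1, 1]%classic)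
  else [set 0].

Lemma compact_span_ball s : compact (span_ball s).
Proof.
elim: s => [|m s IH] /=; first exact: compact_set1.
apply: continuous_compact; last by apply: compact_setX => //; exact: segment_compact.
apply: continuous_subspaceT => -[v a].
apply: cvgD; first exact: cvg_fst.
by apply: cvgZr_tmp; exact: cvg_snd.
Qed.

Context (U : set_system nat) {FU : ProperFilter U}.

(** Each index is chosen from the finite list of its predecessors, so that it works for the whole
    compact set of combinations of the earlier terms; the coefficients need not be known in
    advance. *)
Lemma select_subsequence (Q : nat -> X -> nat -> Prop) : U `=>` \oo ->
  (forall k K, compact K -> \forall m \near U, forall v, K v -> Q k v m) ->
  exists2 phi : nat -> nat, increasing_seq phi &
    forall k (a : nat -> R), (forall i, `|a i| <= 1) ->
      Q k (\sum_(i < k) a i *: x (phi i)) (phi k).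
Proof.
move=> Uoo hQ.
(* [head 0%N s] is the index chosen last. On the empty list the default 0 merely makes the first
   index positive. *)
have next (s : seq nat) : exists m, (head 0%N s < m)%N /\
    forall v, span_ball s v -> Q (size s) v m.
  have H1 : \forall m \near U, (head 0%N s < m)%N.
    by apply: Uoo; exists (head 0%N s).+1.
  have H2 := hQ (size s) _ (@compact_span_ball s).
  exact: filter_ex (filterI H1 H2).
have [f fP] := choice next.
pose s := fix s k := if k is k'.+1 then f (s k') :: s k' else [::].
have size_s k : size (s k) = k by elim: k => //= k ->.
exists (fun k => f (s k)).
  by apply/increasing_seqP => n; have [] := fP (s n.+1).
move=> k a a1; have [_] := fP (s k); rewrite size_s; apply.
elim: k => [|k IH]; first by rewrite big_ord0.
rewrite big_ord_recr /=; exists (\sum_(i < k) a i *: x (f (s i)), a k) => //=.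
by split=> //=; rewrite in_itv/= -ler_norml.
Qed.

(* With [G] the asymptotic norm and [w] the identity, this is the inequality
   [p(v, a + b) <= P(v, a, b)] of part (a); the other parts use other [G] and [w]. *)
Definition step_bound (G : X -> R -> R) (w : R -> R) (S : set R) :=
  forall v a b e, S a -> 0 <= b <= 1 -> 0 < e ->
    \forall m \near U, G v (w a + b) - e <= G (v + a *: x m) b.

(** A bound known at each point [(v, a, b)] becomes uniform by compactness in its near-covering
    form: the Lipschitz properties of [G] and [w] carry it to a neighbourhood of the point that does
    not depend on [m]. *)
Lemma step_bound_uniform G w S K M e : step_bound G w S ->
  compact K -> compact S -> 0 < M -> (forall n, `|x n| <= M) ->
  (forall v v' b b', G v b - G v' b' <= `|v - v'| + M * `|b - b'|) ->
  (forall a a', `|w a - w a'| <= `|a - a'|) -> 0 < e ->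
  \forall m \near U, forall v, K v -> forall a b, S a -> 0 <= b <= 1 ->
    G v (w a + b) - e <= G (v + a *: x m) b.
Proof.
move=> sG cK cS M0 xM lG lw e0.
pose P m (z : X * R * R) :=
  G z.1.1 (w z.1.2 + z.2) - e <= G (z.1.1 + z.1.2 *: x m) z.2.
have cKS : compact (K `*` S `*` `[0, 1]%classic : set (X * R * R)).
  by apply: compact_setX; [exact: compact_setX|exact: segment_compact].
have H : \forall m \near U, K `*` S `*` `[0, 1]%classic `<=` P m.
  apply: (iffLR (compact_near_coveringP _) cKS) => -[[v a] b] [[/= Kv Sa]].
  rewrite in_itv/= => b01.
  (* Two applications of [lG] each cost at most [d * (1 + 2 * M)]; together they use up the
     remaining [e / 2]. *)
  pose d := e / (4 * (1 + 2 * M)).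
  have M1 : 0 < 4 * (1 + 2 * M) by lra.
  have d0 : 0 < d by rewrite divr_gt0.
  have e20 : 0 < e / 2 by lra.
  near=> z m.
  have vz : `|v - z.1.1| < d.
    near: z; apply: (@cvgr_dist_lt _ _ _ _ _ (fun z : X * R * R => z.1.1) v) => //.
    by apply: (@cvg_comp _ _ _ fst fst _ (nbhs (v, a))); exact: cvg_fst.
  have az : `|a - z.1.2| < d.
    near: z; apply: (@cvgr_dist_lt _ _ _ _ _ (fun z : X * R * R => z.1.2) a) => //.
    by apply: (@cvg_comp _ _ _ fst snd _ (nbhs (v, a))); [exact: cvg_fst|exact: cvg_snd].
  have bz : `|b - z.2| < d.
    near: z; apply: (@cvgr_dist_lt _ _ _ _ _ (fun z : X * R * R => z.2) b) => //.
    exact: cvg_snd.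
  have gm : G v (w a + b) - e / 2 <= G (v + a *: x m) b.
    by near: m; exact: sG.
  have h1 := lG (v + a *: x m) (z.1.1 + z.1.2 *: x m) b z.2.
  have h2 := lG z.1.1 v (w z.1.2 + z.2) (w a + b).
  have h3 : `|v + a *: x m - (z.1.1 + z.1.2 *: x m)| <= d + d * M.
    rewrite opprD addrACA -scalerBl; apply: (le_trans (ler_normD _ _)).
    by rewrite normrZ; apply: lerD; [exact: ltW|apply: ler_pM => //; exact: ltW].
  have h4 : `|w z.1.2 + z.2 - (w a + b)| <= d + d.
    rewrite opprD addrACA; apply: (le_trans (ler_normD _ _)); apply: lerD.
      by apply: (le_trans (lw _ _)); rewrite distrC ltW.
    by rewrite distrC ltW.
  have h5 : M * `|b - z.2| <= M * d by rewrite ler_pM2l// ltW.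
  have h6 : M * `|w z.1.2 + z.2 - (w a + b)| <= M * (d + d) by rewrite ler_pM2l.
  have de : d * (1 + 2 * M) * 2 = e / 2.
    by rewrite /d; field; move: M0; lra.
  by rewrite /P; move: vz; rewrite distrC; lra.
by apply: filterS H => m H v Kv a b Sa b01; exact: (H (v, a, b)).
Unshelve. all: by end_near. Qed.

End Selection.

(** * Limits of bounded real sequences along an ultrafilter *)

Section UltraLimits.
Context {R : realType} (U : set_system nat) {FU : UltraFilter U}.

Lemma ultra_fmap (T S : Type) (F : set_system T) (f : T -> S) :
  UltraFilter F -> UltraFilter (f @ F).
Proof.
move=> FF; split=> [|G GG FG]; first exact: fmap_proper_filter.
apply/seteqP; split=> A GA; last exact: FG.
have [//|nA] := in_ultra_setVsetC (f @^-1` A) FF.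
have [y [Ay nAy]] := filter_ex (filterI GA (FG (~` A) nA)).
by case: (nAy Ay).
Qed.

Definition ulim (f : nat -> R) : R := lim (f n @[n --> U]).

(** The image ultrafilter lives on the compact interval [[- C, C]], so it converges there. *)
Lemma ulim_cvg f C : (forall n, `|f n| <= C) -> f @ U --> ulim f.
Proof.
move=> fC; have := @segment_compact R (- C) C; rewrite compact_ultra => /(_ (f @ U)).
case; first exact: ultra_fmap.
  by apply: nearW => n; rewrite /= in_itv/= -ler_norml.
by move=> l [_ fl]; exact: cvgP fl.
Qed.

Lemma ulimE f l : f @ U --> l -> ulim f = l.
Proof. by move=> fl; apply: cvg_lim. Qed.

Lemma cvg_dist0 (f g h : nat -> R) (l : R) : g @ U --> l -> h @ U --> (0 : R) ->
  (forall n, `|f n - g n| <= h n) -> f @ U --> l.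
Proof.
move=> gl h0 fgh.
apply/cvgrPdist_lt => e e0; have e2 : 0 < e / 2 by lra.
near=> n.
have gn : `|l - g n| < e / 2 by near: n; apply: cvgr_dist_lt.
have hn : `|0 - h n| < e / 2 by near: n; apply: cvgr_dist_lt.
have := fgh n; have := ler_distD (g n) l (f n); rewrite (distrC (g n)).
by move: hn; rewrite sub0r normrN; have := ler_norm (h n); lra.
Unshelve. all: by end_near. Qed.

End UltraLimits.

(** * The asymptotic norms of a sequence, simple and iterated *)

Section AsymptoticNorm.
Context {R : realType} {X : normedModType R}.
Context (U : set_system nat) {FU : UltraFilter U} (x : nat -> X) (M : R).
Hypothesis (xM : forall n, `|x n| <= M).

Definition asymptotic_norm (v : X) (b : R) : R := ulim U (fun n => `|v + b *: x n|).

Local Notation p := asymptotic_norm.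

Let norm_bound v b n : `|v + b *: x n| <= `|v| + `|b| * M.
Proof.
by apply: (le_trans (ler_normD _ _)); rewrite lerD2l normrZ ler_wpM2l.
Qed.

Lemma asymptotic_norm_cvg v b : `|v + b *: x n| @[n --> U] --> p v b.
Proof.
by apply: (@ulim_cvg _ _ _ _ (`|v| + `|b| * M)) => n; rewrite normr_id.
Qed.

Lemma asymptotic_norm_le v b : 0 <= p v b <= `|v| + `|b| * M.
Proof.
apply/andP; split.
  by apply: ler_cvg_to (cvg_cst 0) (@asymptotic_norm_cvg v b) _; exact: nearW.
apply: ler_cvg_to (@asymptotic_norm_cvg v b) (cvg_cst _) _.
exact: nearW.
Qed.

Lemma asymptotic_norm_lip v v' b b' :
  p v b - p v' b' <= `|v - v'| + M * `|b - b'|.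
Proof.
apply: ler_cvg_to (cvgB (@asymptotic_norm_cvg v b) (@asymptotic_norm_cvg v' b'))
  (cvg_cst _) _.
apply: nearW => n /=; rewrite fctE; apply: (le_trans (lerB_dist _ _)).
rewrite opprD addrACA -scalerBl; apply: (le_trans (ler_normD _ _)).
by rewrite lerD2l normrZ mulrC ler_wpM2r.
Qed.

Lemma asymptotic_normD v v' b b' : p (v + v') (b + b') <= p v b + p v' b'.
Proof.
apply: ler_cvg_to (@asymptotic_norm_cvg _ _)
  (cvgD (@asymptotic_norm_cvg v b) (@asymptotic_norm_cvg v' b')) _.
by apply: nearW => n /=; rewrite scalerDl addrACA ler_normD.
Qed.

Lemma asymptotic_normZ t v b : p (t *: v) (t * b) = `|t| * p v b.
Proof.
apply: ulimE; apply: cvg_trans (cvgM (cvg_cst _) (@asymptotic_norm_cvg v b)).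
by apply: near_eq_cvg; apply: nearW => n /=; rewrite -scalerA -scalerDr normrZ.
Qed.

Lemma asymptotic_norm0 v : p v 0 = `|v|.
Proof.
apply: ulimE; rewrite (_ : (fun _ => _) = (fun=> `|v|)); first exact: cvg_cst.
by apply/funext => n; rewrite scale0r addr0.
Qed.

Definition asymptotic_norm2 v a b : R := ulim U (fun m => p (v + a *: x m) b).

Local Notation P2 := asymptotic_norm2.

Lemma asymptotic_norm2_cvg v a b : p (v + a *: x m) b @[m --> U] --> P2 v a b.
Proof.
apply: (@ulim_cvg _ _ _ _ (`|v| + `|a| * M + `|b| * M)) => m.
have /andP[p0 pM] := asymptotic_norm_le (v + a *: x m) b.
by rewrite ger0_norm//; apply: (le_trans pM); rewrite lerD2r.
Qed.

Lemma asymptotic_norm2_lip v v' a b : P2 v a b - P2 v' a b <= `|v - v'|.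
Proof.
apply: ler_cvg_to (cvgB (@asymptotic_norm2_cvg v a b) (@asymptotic_norm2_cvg v' a b))
  (cvg_cst _) _.
apply: nearW => m /=; rewrite fctE; apply: (le_trans (asymptotic_norm_lip _ _ _ _)).
by rewrite subrr normr0 mulr0 addr0 opprD addrACA subrr addr0.
Qed.

Lemma asymptotic_norm2D v v' a a' b b' :
  P2 (v + v') (a + a') (b + b') <= P2 v a b + P2 v' a' b'.
Proof.
apply: ler_cvg_to (@asymptotic_norm2_cvg _ _ _)
  (cvgD (@asymptotic_norm2_cvg v a b) (@asymptotic_norm2_cvg v' a' b')) _.
apply: nearW => m /=; rewrite scalerDl addrACA; exact: asymptotic_normD.
Qed.

Lemma asymptotic_norm2Z t v a b : P2 (t *: v) (t * a) (t * b) = `|t| * P2 v a b.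
Proof.
apply: ulimE; apply: cvg_trans (cvgM (cvg_cst _) (@asymptotic_norm2_cvg v a b)).
apply: near_eq_cvg; apply: nearW => m /=.
by rewrite -scalerA -scalerDr asymptotic_normZ.
Qed.

Lemma asymptotic_norm20l v b : P2 v 0 b = p v b.
Proof.
apply: ulimE; rewrite (_ : (fun _ => _) = (fun=> p v b)); first exact: cvg_cst.
by apply/funext => n; rewrite scale0r addr0.
Qed.

Lemma asymptotic_norm20r v a : P2 v a 0 = p v a.
Proof.
apply: ulimE; apply: cvg_trans (@asymptotic_norm_cvg v a); apply: near_eq_cvg.
by apply: nearW => n /=; rewrite asymptotic_norm0.
Qed.

(** The scalar inside [two_norm] varies with [n]. Replacing it by its limit [p z b] changes each of
    the two norms by at most |y| times a quantity that tends to 0. *)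
Lemma two_norm_cvg y z b : two_norm y (z + b *: x n) @[n --> U] -->
  p (p z b *: y + z) b + p (p z b *: y - z) (- b).
Proof.
set r := p z b.
apply: (cvg_dist0 (cvgD (@asymptotic_norm_cvg (r *: y + z) b)
  (@asymptotic_norm_cvg (r *: y - z) (- b))) (h :=
    fun n => 2 * `|y| * `| `|z + b *: x n| - r |)) => [|n].
  have -> : 0 = 2 * `|y| * `|r - r| by rewrite subrr normr0 mulr0.
  apply: cvgM; first exact: cvg_cst.
  apply: cvg_norm; apply: cvgB; [exact: asymptotic_norm_cvg|exact: cvg_cst].
rewrite fctE /two_norm; set w := z + b *: x n; set s := `|w|.
have -> : r *: y + z + b *: x n = r *: y + w by rewrite addrA.
have -> : r *: y - z + - b *: x n = r *: y - w by rewrite scaleNr opprD addrA.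
have h e : `| `|s *: y + e| - `|r *: y + e| | <= `|y| * `|s - r|.
  apply: (le_trans (ler_dist_dist _ _)).
  by rewrite opprD addrACA subrr addr0 -scalerBl normrZ mulrC.
by have := h w; have := h (- w); rewrite !ler_norml; lra.
Qed.

(** The same replacement in the outer limit; in its use the scalar is the inner limit
    [p (x m) eps]. *)
Lemma asymptotic_norm2_perturb (s : nat -> R) (s0 : R) y v a b : s @ U --> s0 ->
  p (s m *: y + v + a *: x m) b @[m --> U] --> P2 (s0 *: y + v) a b.
Proof.
move=> ss0.
apply: (cvg_dist0 (@asymptotic_norm2_cvg (s0 *: y + v) a b)
  (h := fun m => `|s m - s0| * `|y|)) => [|m].
  have -> : 0 = `|s0 - s0| * `|y| by rewrite subrr normr0 mul0r.
  apply: cvgM; last exact: cvg_cst.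
  by apply: cvg_norm; apply: cvgB => //; exact: cvg_cst.
have E1 : s m *: y + v + a *: x m - (s0 *: y + v + a *: x m) = (s m - s0) *: y.
  by rewrite !opprD addrACA subrr addr0 addrACA subrr addr0 -scalerBl.
have := asymptotic_norm_lip (s m *: y + v + a *: x m) (s0 *: y + v + a *: x m) b b.
have := asymptotic_norm_lip (s0 *: y + v + a *: x m) (s m *: y + v + a *: x m) b b.
rewrite -[_ + _ - _]opprB E1 normrN subrr normr0 mulr0 addr0 normrZ => h1 h2.
by rewrite ler_norml; lra.
Qed.

End AsymptoticNorm.

(** * Iterated limits of seminorms and the splitting of an equality *)

Section IteratedLimits.
Context {R : realType} {X : normedModType R}.
Context (U : set_system nat) {FU : UltraFilter U} (x : nat -> X) (M : R).
Hypothesis (xM : forall n, `|x n| <= M).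

Local Notation p := (asymptotic_norm U x).
Local Notation P2 := (asymptotic_norm2 U x).

Definition ulim1 (rho : X -> R) := ulim U (fun n => rho (x n)).

Definition ulim2 (eps : R) (rho : X -> R) :=
  ulim U (fun m => ulim U (fun n => rho (x m + eps *: x n))).

Definition bounded_seminorm (rho : X -> R) :=
  seminorm rho /\ exists2 C, 0 < C & forall y, rho y <= C * `|y|.

Lemma bounded_seminorm_lip (rho : X -> R) : seminorm rho -> forall C,
  (forall y, rho y <= C * `|y|) -> forall y z, `|rho y - rho z| <= C * `|y - z|.
Proof.
move=> sr C rC y z; rewrite ler_norml.
have := sr.2 (y - z) z; rewrite subrK.
have := sr.2 (z - y) y; rewrite subrK.
have := rC (y - z); have := rC (z - y); rewrite (distrC z); lra.
Qed.

Section seminorm_limits.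
Variables (rho : X -> R) (eps : R).
Hypothesis br : bounded_seminorm rho.

Lemma ulim_seminorm_cvg v : rho (v + eps *: x n) @[n --> U] -->
  ulim U (fun n => rho (v + eps *: x n)).
Proof.
have [sr [C C0 rC]] := br.
apply: (@ulim_cvg _ _ _ _ (C * (`|v| + `|eps| * M))) => n.
rewrite ger0_norm ?seminorm_ge0//; apply: (le_trans (rC _)).
rewrite ler_pM2l//; apply: (le_trans (ler_normD _ _)).
by rewrite lerD2l normrZ ler_wpM2l.
Qed.

Lemma ulim1_cvg : rho (x n) @[n --> U] --> ulim1 rho.
Proof.
have [sr [C C0 rC]] := br.
apply: (@ulim_cvg _ _ _ _ (C * M)) => n.
rewrite ger0_norm ?seminorm_ge0//; apply: (le_trans (rC _)).
by rewrite ler_pM2l.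
Qed.

Lemma ulim2_cvg : ulim U (fun n => rho (x m + eps *: x n)) @[m --> U] -->
  ulim2 eps rho.
Proof.
have [sr [C C0 rC]] := br.
apply: (@ulim_cvg _ _ _ _ (C * (M + `|eps| * M))) => m.
rewrite ger0_norm.
  apply: ler_cvg_to (@ulim_seminorm_cvg (x m)) (cvg_cst _) _.
  apply: nearW => n /=; apply: (le_trans (rC _)); rewrite ler_pM2l//.
  by apply: (le_trans (ler_normD _ _)); rewrite normrZ lerD// ler_wpM2l.
apply: ler_cvg_to (cvg_cst 0) (@ulim_seminorm_cvg (x m)) _.
by apply: nearW => n; exact: seminorm_ge0.
Qed.

Lemma ulim2_le : `|eps| = 1 -> ulim2 eps rho <= 2 * ulim1 rho.
Proof.
move=> e1; have [sr _] := br; rewrite mulr_natl mulr2n.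
apply: ler_cvg_to ulim2_cvg (cvgD ulim1_cvg (cvg_cst (ulim1 rho))) _.
apply: nearW => m /=; rewrite fctE.
apply: ler_cvg_to (@ulim_seminorm_cvg (x m)) (cvgD (cvg_cst (rho (x m))) ulim1_cvg) _.
apply: nearW => n /=; rewrite fctE; apply: (le_trans (sr.2 _ _)).
by rewrite sr.1 e1 mul1r.
Qed.

End seminorm_limits.

(* Weak lower semicontinuity at [0] of the convex function
   [v |-> lim_n rho (v + x n)]. *)
Lemma ulim1_le_ulim2 (rho : X -> R) : (x : nat -> weak X) @ U --> (0 : weak X) ->
  bounded_seminorm rho -> ulim1 rho <= ulim2 1 rho.
Proof.
move=> x0 br; have [sr [C C0 rC]] := br.
pose q v := ulim U (fun n => rho (v + 1 *: x n)).
have qcvg v : rho (v + 1 *: x n) @[n --> U] --> q v by exact: ulim_seminorm_cvg.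
have -> : ulim1 rho = q 0.
  by rewrite /ulim1 /q; congr ulim; apply/funext => n; rewrite add0r scale1r.
apply: (@weak_lsc _ _ _ U x 0 q C) => //; last exact: ulim2_cvg.
  move=> y z t /andP[t0 t1].
  apply: ler_cvg_to (qcvg _) (cvgD (cvgM (cvg_cst t) (qcvg y))
    (cvgM (cvg_cst (1 - t)) (qcvg z))) _.
  apply: nearW => n /=; rewrite fctE /=.
  have -> : t *: y + (1 - t) *: z + 1 *: x n =
      t *: (y + 1 *: x n) + (1 - t) *: (z + 1 *: x n).
    rewrite !scale1r !scalerDr addrACA -scalerDl.
    by rewrite [t + _]addrCA subrr addr0 scale1r.
  apply: (le_trans (sr.2 _ _)); rewrite !sr.1 !ger0_norm//.
  by rewrite subr_ge0.
suff h y z : q y - q z <= C * `|y - z|.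
  by move=> y z; rewrite ler_norml; have := h y z; have := h z y;
    rewrite (distrC z); lra.
apply: ler_cvg_to (cvgB (qcvg y) (qcvg z)) (cvg_cst _) _.
apply: nearW => n /=; rewrite fctE.
have := bounded_seminorm_lip sr rC (y + 1 *: x n) (z + 1 *: x n).
rewrite opprD addrACA subrr addr0; apply: le_trans; exact: ler_norm.
Qed.

(** When the same inequality holds for both summands, equality for their sum leaves no slack in
    either. The first alternative comes from the triangle inequality with [kappa = 2], the second
    from weak lower semicontinuity with [kappa = 1]. *)
Lemma ulim_summand (N sigma tau : X -> R) (c eps kappa : R) : 0 < c ->
  bounded_seminorm sigma -> bounded_seminorm tau ->
  (forall y, N y = c * sigma y + tau y) ->
  (forall rho, bounded_seminorm rho -> ulim2 eps rho <= kappa * ulim1 rho) \/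
  (forall rho, bounded_seminorm rho -> kappa * ulim1 rho <= ulim2 eps rho) ->
  ulim2 eps N = kappa * ulim1 N -> ulim2 eps sigma = kappa * ulim1 sigma.
Proof.
move=> c0 bs bt Nst H.
have -> : ulim1 N = c * ulim1 sigma + ulim1 tau.
  apply: ulimE; under eq_fun do rewrite Nst.
  by apply: cvgD; [apply: cvgM; [exact: cvg_cst|]|]; exact: ulim1_cvg.
have -> : ulim2 eps N = c * ulim2 eps sigma + ulim2 eps tau.
  apply: ulimE.
  have -> : (fun m => ulim U (fun n => N (x m + eps *: x n))) = (fun m =>
      c * ulim U (fun n => sigma (x m + eps *: x n)) +
      ulim U (fun n => tau (x m + eps *: x n))).
    apply/funext => m; apply: ulimE; under eq_fun do rewrite Nst.
    apply: cvgD; [apply: cvgM; [exact: cvg_cst|]|]; exact: ulim_seminorm_cvg.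
  by apply: cvgD; [apply: cvgM; [exact: cvg_cst|]|]; exact: ulim2_cvg.
move=> E.
have {}E : c * (ulim2 eps sigma - kappa * ulim1 sigma) =
  kappa * ulim1 tau - ulim2 eps tau by lra.
apply/eqP; rewrite eq_le; case: H => H; rewrite H//=.
  rewrite -subr_ge0 -(pmulr_rge0 _ c0) E subr_ge0; exact: H.
rewrite andbT -subr_le0 -(pmulr_rle0 _ c0) E subr_le0; exact: H.
Qed.

Lemma bounded_seminorm_two_norm y : bounded_seminorm (two_norm y).
Proof.
split; first exact: seminorm_two_norm.
exists (2 * (1 + `|y|)); last by move=> z; exact: two_norm_le.
by rewrite mulr_gt0// ltr_wpDr.
Qed.

Lemma ulim1_two_norm y :
  ulim1 (two_norm y) = p (p 0 1 *: y) 1 + p (p 0 1 *: y) (- 1).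
Proof.
apply: ulimE; have := two_norm_cvg (FU := FU) xM (y := y) (z := 0) (b := 1); rewrite addr0 subr0.
by under eq_fun do rewrite add0r scale1r.
Qed.

(** The case of [two_norm 0], twice the norm, shows that the inner limits [p (x m) eps] tend to
    [kappa * p 0 1]. This value then replaces the varying scalar in [two_norm y]. *)
Lemma two_norm_identity eps kappa y :
  ulim2 eps (two_norm 0) = kappa * ulim1 (two_norm 0) ->
  ulim2 eps (two_norm y) = kappa * ulim1 (two_norm y) ->
  P2 (kappa * p 0 1 *: y) 1 eps + P2 (kappa * p 0 1 *: y) (- 1) (- eps) =
  kappa * (p (p 0 1 *: y) 1 + p (p 0 1 *: y) (- 1)).
Proof.
have E2 z : (fun m => ulim U (fun n => two_norm z (x m + eps *: x n))) = (fun m =>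
    p (p (x m) eps *: z + x m) eps + p (p (x m) eps *: z - x m) (- eps)).
  by apply/funext => m; apply: ulimE; exact: two_norm_cvg.
move=> H0 Hy.
have rm : p (x m) eps @[m --> U] --> kappa * p 0 1.
  have := ulim2_cvg (eps := eps) (bounded_seminorm_two_norm 0).
  rewrite H0 ulim1_two_norm E2 !scaler0.
  have -> : p 0 (- 1) = p 0 1.
    by have := asymptotic_normZ (FU := FU) xM (-1) 0 1; rewrite scaler0 mulr1 normrN1 mul1r.
  move=> H.
  have -> : (fun m => p (x m) eps) = (fun m => 2^-1 * (p (p (x m) eps *: 0 + x m) eps +
      p (p (x m) eps *: 0 - x m) (- eps))).
    apply/funext => m; rewrite scaler0 add0r sub0r.
    have := asymptotic_normZ (FU := FU) xM (-1) (x m) eps.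
    by rewrite scaleN1r mulN1r normrN1 mul1r => ->; field.
  have -> : kappa * p 0 1 = 2^-1 * (kappa * (p 0 1 + p 0 1)) by field.
  apply: cvgM; [exact: cvg_cst|exact: H].
rewrite -ulim1_two_norm -Hy; apply/esym; apply: ulimE; rewrite E2.
have h1 := asymptotic_norm2_perturb (FU := FU) xM (y := y) (v := 0) (a := 1) (b := eps) rm.
have h2 := asymptotic_norm2_perturb (FU := FU) xM (y := y) (v := 0) (a := -1) (b := - eps) rm.
rewrite addr0 in h1; rewrite addr0 in h2.
apply: cvg_trans (cvgD h1 h2); apply: near_eq_cvg; apply: nearW => m /=.
by rewrite fctE !addr0 scale1r scaleN1r.
Qed.

End IteratedLimits.

(** * The identity between simple and iterated asymptotic norms at every point of the space *)

Section Identity.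
Context {R : realType} {X : normedModType R}.
Context (U : set_system nat) {FU : UltraFilter U} (x : nat -> X) (M : R).
Hypothesis (xM : forall n, `|x n| <= M).
Variables (d : nat -> X) (N : X -> R) (eps kappa : R).

Local Notation p := (asymptotic_norm U x).
Local Notation P2 := (asymptotic_norm2 U x).

Hypotheses (d0 : d 0 = 0)
  (dense_d : forall y e, 0 < e -> exists k, `|d k - y| < e)
  (normN : is_norm N) (N2 : forall y, `|y| <= N y <= 2 * `|y|)
  (splitN : forall k, exists c tau, [/\ 0 < c, seminorm tau &
    forall y, N y = c * two_norm (d k) y + tau y])
  (onesided : (forall rho, bounded_seminorm rho ->
      ulim2 U x eps rho <= kappa * ulim1 U x rho) \/
    (forall rho, bounded_seminorm rho ->
      kappa * ulim1 U x rho <= ulim2 U x eps rho))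
  (kappa0 : 0 < kappa) (limN0 : 0 < ulim1 U x N)
  (limN : ulim2 U x eps N = kappa * ulim1 U x N).

Lemma bounded_seminorm_renorming : bounded_seminorm N.
Proof.
by case: normN => _ NZ ND; split=> //; exists 2 => // y; have /andP[] := N2 y.
Qed.

Let dk_eq k : ulim2 U x eps (two_norm (d k)) = kappa * ulim1 U x (two_norm (d k)).
Proof.
have [c [tau [c0 st Nst]]] := splitN k.
apply: (ulim_summand xM c0 _ _ Nst onesided limN).
  exact: bounded_seminorm_two_norm.
split=> //; exists 2 => // y; have /andP[_ +] := N2 y; rewrite Nst; apply: le_trans.
by rewrite lerDr mulr_ge0// ?(ltW c0)// addr_ge0.
Qed.

Lemma asymptotic_norm_gt0 : 0 < p 0 1.
Proof.
have : ulim1 U x N <= 2 * p 0 1.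
  have h : 2 * `|0 + 1 *: x n| @[n --> U] --> 2 * p 0 1.
    by apply: cvgM; [exact: cvg_cst|exact: asymptotic_norm_cvg].
  apply: ler_cvg_to (ulim1_cvg xM bounded_seminorm_renorming) h _.
  by apply: nearW => n; rewrite add0r scale1r; have /andP[] := N2 (x n).
by move: limN0; lra.
Qed.

(** [two_norm_identity] gives the equality at the multiples of the [d k] by [kappa * p 0 1]; these
    are dense because that factor is positive, and both sides are Lipschitz in [y]. *)
Lemma asymptotic_identity1 y :
  P2 y 1 eps + P2 y (- 1) (- eps) = p y kappa + p y (- kappa).
Proof.
have s0 := asymptotic_norm_gt0.
have ks0 : 0 < kappa * p 0 1 by exact: mulr_gt0.
have E k : let z := (kappa * p 0 1) *: d k in
    P2 z 1 eps + P2 z (- 1) (- eps) = p z kappa + p z (- kappa).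
  have H0 := dk_eq 0; rewrite d0 in H0; rewrite /=.
  rewrite (two_norm_identity xM H0 (dk_eq k)).
  have pk v b : kappa * p v b = p (kappa *: v) (kappa * b).
    by rewrite (asymptotic_normZ xM) gtr0_norm.
  by rewrite mulrDr !(pk (p 0 1 *: d k)) scalerA mulr1 mulrN1.
apply/eqP; rewrite -subr_eq0 -normr_le0; apply/ler_addgt0Pr => e e0.
(* Four terms are compared at [z] and at [y], each contributing [e / 4]. *)
have [z Ez zy] : exists2 z,
    P2 z 1 eps + P2 z (- 1) (- eps) = p z kappa + p z (- kappa) & `|z - y| <= e / 4.
  have [k dk] : exists k, `|d k - (kappa * p 0 1)^-1 *: y| < e / 4 / (kappa * p 0 1).
    by apply: dense_d; rewrite !divr_gt0.
  exists ((kappa * p 0 1) *: d k); first exact: E.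
  have -> : (kappa * p 0 1) *: d k - y =
      (kappa * p 0 1) *: (d k - (kappa * p 0 1)^-1 *: y).
    by rewrite scalerBr scalerA mulfV ?scale1r// gt_eqF.
  by rewrite normrZ gtr0_norm// mulrC -ler_pdivlMr// ltW.
have yz : `|y - z| <= e / 4 by rewrite distrC.
have l2 a b u v : `|u - v| <= e / 4 -> P2 u a b - P2 v a b <= e / 4.
  by apply: le_trans; exact: asymptotic_norm2_lip.
have l1 b u v : `|u - v| <= e / 4 -> p u b - p v b <= e / 4.
  apply: le_trans; apply: le_trans (asymptotic_norm_lip xM u v b b) _.
  by rewrite subrr normr0 mulr0 addr0.
rewrite add0r ler_norml.
move: Ez (l2 1 eps _ _ zy) (l2 1 eps _ _ yz) (l2 (-1) (- eps) _ _ zy)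
  (l2 (-1) (- eps) _ _ yz) (l1 kappa _ _ zy) (l1 kappa _ _ yz)
  (l1 (- kappa) _ _ zy) (l1 (- kappa) _ _ yz).
move: (P2 z 1 eps) (P2 y 1 eps) (P2 z (-1) (- eps)) (P2 y (-1) (- eps)).
move: (p z kappa) (p y kappa) (p z (- kappa)) (p y (- kappa)).
by move=> *; lra.
Qed.

Lemma asymptotic_identity y c : 0 < c ->
  P2 y c (c * eps) + P2 y (- c) (- (c * eps)) = p y (c * kappa) + p y (- (c * kappa)).
Proof.
move=> c0; have := asymptotic_identity1 (c^-1 *: y).
have pc v b : c * p v b = p (c *: v) (c * b).
  by rewrite (asymptotic_normZ xM) gtr0_norm.
have p2c v a b : c * P2 v a b = P2 (c *: v) (c * a) (c * b).
  by rewrite (asymptotic_norm2Z xM) gtr0_norm.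
move=> /(congr1 (fun r => c * r)); rewrite !mulrDr !pc !p2c.
by rewrite scalerA mulfV ?gt_eqF// scale1r !mulrN !mulr1.
Qed.

End Identity.

(** * One-step bounds for the three properties *)

Section StepBounds.
Context {R : realType} {X : normedModType R}.
Context (U : set_system nat) {FU : UltraFilter U} (x : nat -> X) (M : R).
Hypothesis (xM : forall n, `|x n| <= M).

Local Notation p := (asymptotic_norm U x).
Local Notation P2 := (asymptotic_norm2 U x).

(** The midpoint lies between [t] and the end of [[0, 1]] on its other side, so by convexity a value
    [f t] below the chord would push [f 2^-1] below the chord too. *)
Lemma midpoint_concave_ge (f : R -> R) t :
  (forall a b s, 0 <= a <= 1 -> 0 <= b <= 1 -> 0 <= s <= 1 ->
    f (s * a + (1 - s) * b) <= s * f a + (1 - s) * f b) ->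
  (f 0 + f 1) / 2 <= f 2^-1 -> 0 <= t <= 1 -> (1 - t) * f 0 + t * f 1 <= f t.
Proof.
move=> cf f2 /andP[t0 t1].
have [th|th] := leP t 2^-1.
  pose s := 2^-1 / (1 - t).
  have t1' : 0 < 1 - t by lra.
  have s01 : 0 <= s <= 1.
    by rewrite /s divr_ge0 ?(ltW t1')//= ler_pdivrMr// mul1r; lra.
  have tt : 0 <= t <= 1 by rewrite t0.
  have := cf t 1 s tt _ s01; rewrite ler01 lexx /= => /(_ isT).
  have st : s * (1 - t) = 2^-1 by rewrite /s mulfVK// gt_eqF.
  have -> : s * t + (1 - s) * 1 = 2^-1 by lra.
  move=> h; have {}h : (f 0 + f 1) / 2 <= s * f t + (1 - s) * f 1 by lra.
  have := ler_wpM2r (ltW t1') h.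
  have -> : (s * f t + (1 - s) * f 1) * (1 - t) =
    (s * (1 - t)) * f t + (1 - t - s * (1 - t)) * f 1 by ring.
  rewrite st; lra.
pose s := 2^-1 / t.
have t0' : 0 < t by lra.
have s01 : 0 <= s <= 1.
  by rewrite /s divr_ge0 ?(ltW t0')//= ler_pdivrMr// mul1r ltW.
have tt : 0 <= t <= 1 by rewrite t0.
have := cf t 0 s tt _ s01; rewrite ler01 lexx /= => /(_ isT).
have st : s * t = 2^-1 by rewrite /s mulfVK// gt_eqF.
rewrite mulr0 addr0 st => h.
have {}h : (f 0 + f 1) / 2 <= s * f t + (1 - s) * f 0 by lra.
have := ler_wpM2r (ltW t0') h.
have -> : (s * f t + (1 - s) * f 0) * t =
  (s * t) * f t + (t - s * t) * f 0 by ring.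
rewrite st; lra.
Qed.

Lemma asymptotic_norm2_convex v a b a' b' s : 0 <= s <= 1 ->
  P2 v (s * a + (1 - s) * a') (s * b + (1 - s) * b') <=
    s * P2 v a b + (1 - s) * P2 v a' b'.
Proof.
move=> /andP[s0 s1]; have s1' : 0 <= 1 - s by rewrite subr_ge0.
have P2Z r c d : 0 <= r -> r * P2 v c d = P2 (r *: v) (r * c) (r * d).
  by move=> r0; rewrite (asymptotic_norm2Z xM) ger0_norm.
rewrite !P2Z//; have {1}-> : v = s *: v + (1 - s) *: v.
  by rewrite -scalerDl addrCA subrr addr0 scale1r.
exact: asymptotic_norm2D xM _ _ _ _ _ _.
Qed.

Lemma asymptotic_normN v b : p (- v) (- b) = p v b.
Proof.
by rewrite -scaleN1r -(mulN1r b) (asymptotic_normZ xM) normrN1 mul1r.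
Qed.

Lemma asymptotic_norm2N v a b : P2 (- v) (- a) (- b) = P2 v a b.
Proof.
by rewrite -scaleN1r -(mulN1r a) -(mulN1r b) (asymptotic_norm2Z xM) normrN1 mul1r.
Qed.

(** The pair [(a, b)] is the midpoint of [(2 * a, 0)] and [(0, 2 * b)], where [P2] reduces to
    [p]. *)
Lemma asymptotic_norm2_le_mid v a b :
  P2 v a b <= (p v (2 * a) + p v (2 * b)) / 2.
Proof.
have h c : p (2^-1 *: v) c = p v (2 * c) / 2.
  have := asymptotic_normZ (FU := FU) xM 2^-1 v (2 * c).
  by rewrite mulKf// gtr0_norm// mulrC.
have := asymptotic_norm2D (FU := FU) xM (2^-1 *: v) (2^-1 *: v) a 0 0 b.
rewrite addr0 add0r -scalerDl (_ : 2^-1 + 2^-1 = 1); last by field.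
rewrite scale1r (asymptotic_norm20r xM) (asymptotic_norm20l (FU := FU)) !h.
lra.
Qed.

Section same_sign.
Hypothesis same : forall y c, 0 < c ->
  P2 y c c + P2 y (- c) (- c) = p y (c * 2) + p y (- (c * 2)).

(** On the segment from [(0, c)] to [(c, 0)], with [c = a + b], both end values are [p v c]. The
    identity at [c / 2], with [asymptotic_norm2_le_mid] bounding each term on its left, forces the
    midpoint value to be [p v c] as well, and convexity does the rest. *)
Lemma asymptotic_norm2_ge_add v a b : 0 <= a -> 0 <= b -> p v (a + b) <= P2 v a b.
Proof.
move=> a0 b0; pose c := a + b.
have [c0|c0] := eqVneq c 0.
  have [-> ->] : a = 0 /\ b = 0 by move: c0; rewrite /c; split; lra.
  by rewrite addr0 (asymptotic_norm20r xM).
have {}c0 : 0 < c by rewrite lt_neqAle eq_sym c0 addr_ge0.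
pose f t := P2 v (t * c) ((1 - t) * c).
have := @midpoint_concave_ge f (a / c).
have -> : f 0 = p v c.
  by rewrite /f mul0r subr0 mul1r (asymptotic_norm20l (FU := FU)).
have -> : f 1 = p v c by rewrite /f mul1r subrr mul0r (asymptotic_norm20r xM).
have -> : f (a / c) = P2 v a b.
  rewrite /f mulrBl mul1r mulfVK ?gt_eqF//; congr P2; rewrite /c; ring.
rewrite -mulrDl subrK mul1r; apply.
- move=> s t r s01 t01 r01; rewrite /f.
  have -> : (r * s + (1 - r) * t) * c = r * (s * c) + (1 - r) * (t * c) by ring.
  have -> : (1 - (r * s + (1 - r) * t)) * c =
    r * ((1 - s) * c) + (1 - r) * ((1 - t) * c) by ring.
  exact: asymptotic_norm2_convex.
- have c2 : 0 < c / 2 by rewrite divr_gt0.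
  have h1 : 2^-1 * c = c / 2 by rewrite mulrC.
  have h2 : (1 - 2^-1) * c = c / 2 by field.
  rewrite /f h1 h2.
  have := same v c2; have := asymptotic_norm2_le_mid v (c / 2) (c / 2).
  have := asymptotic_norm2_le_mid v (- (c / 2)) (- (c / 2)).
  rewrite mulrN (mulrC 2) mulfVK// -/c; lra.
- by rewrite divr_ge0 ?(ltW c0)//= ler_pdivrMr// mul1r lerDl.
Qed.

Lemma step_bound_asymptotic_norm : step_bound x U p id `[0, 1]%classic.
Proof.
move=> v a b e /=; rewrite in_itv/= => /andP[a0 _] /andP[b0 _] e0.
have h := asymptotic_norm2_ge_add v a0 b0.
have le : p v (a + b) - e < P2 v a b by lra.
near=> m; apply/ltW; near: m.
by apply: (cvgr_gt (P2 v a b)) => //; exact: asymptotic_norm2_cvg xM _ _ _.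
Unshelve. all: by end_near. Qed.

Hypothesis opposite : forall y c, 0 < c ->
  P2 y c (- c) + P2 y (- c) c = p y (c * 2) + p y (- (c * 2)).

(** With opposite signs the segment runs from [(0, - c)] to [(c, 0)], and its end values [p v (- c)]
    and [p v c] may differ; their minimum is a bound that does not depend on the signs. *)
Definition symmetrized_norm v c := Num.min (p v c) (p v (- c)).
Local Notation u := symmetrized_norm.

Let ge_sub v a b : 0 <= a -> 0 <= b -> u v (a + b) <= P2 v a (- b).
Proof.
move=> a0 b0; pose c := a + b.
have [c0|c0] := eqVneq c 0.
  have [-> ->] : a = 0 /\ b = 0 by move: c0; rewrite /c; split; lra.
  by rewrite oppr0 addr0 (asymptotic_norm20r xM) /u oppr0 minxx.
have {}c0 : 0 < c by rewrite lt_neqAle eq_sym c0 addr_ge0.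
pose f t := P2 v (t * c) (- ((1 - t) * c)).
have := @midpoint_concave_ge f (a / c).
have -> : f 0 = p v (- c).
  by rewrite /f mul0r subr0 mul1r (asymptotic_norm20l (FU := FU)).
have -> : f 1 = p v c.
  by rewrite /f mul1r subrr mul0r oppr0 (asymptotic_norm20r xM).
have -> : f (a / c) = P2 v a (- b).
  rewrite /f mulrBl mul1r mulfVK ?gt_eqF//; congr P2; rewrite /c; ring.
move=> H; have ac01 : 0 <= a / c <= 1.
  by rewrite divr_ge0 ?(ltW c0)//= ler_pdivrMr// mul1r lerDl.
apply: le_trans (H _ _ ac01).
- have uc : u v c <= p v c by rewrite /u ge_min lexx.
  have uNc : u v c <= p v (- c) by rewrite /u ge_min lexx orbT.
  move: ac01 => /andP[t0 t1].
  have := ler_wpM2l t0 uc.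
  have t1' : 0 <= 1 - a / c by rewrite subr_ge0.
  have := ler_wpM2l t1' uNc; rewrite -/c; lra.
- move=> s t r s01 t01 r01; rewrite /f.
  have -> : (r * s + (1 - r) * t) * c = r * (s * c) + (1 - r) * (t * c) by ring.
  have -> : - ((1 - (r * s + (1 - r) * t)) * c) =
    r * - ((1 - s) * c) + (1 - r) * - ((1 - t) * c) by ring.
  exact: asymptotic_norm2_convex.
(* [P2 v (- (c / 2)) (c / 2)] is at most the mean of the two end values, so the identity leaves at
   least that mean for the midpoint. *)
- have c2 : 0 < c / 2 by rewrite divr_gt0.
  have h1 : 2^-1 * c = c / 2 by rewrite mulrC.
  have h2 : (1 - 2^-1) * c = c / 2 by field.
  rewrite /f h1 h2.
  have := opposite v c2; have := asymptotic_norm2_le_mid v (c / 2) (- (c / 2)).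
  have := asymptotic_norm2_le_mid v (- (c / 2)) (c / 2).
  rewrite mulrN (mulrC 2) mulfVK// -/c; lra.
Qed.

Lemma symmetrized_norm_le v a b : u v (`|a| + `|b|) <= P2 v a b.
Proof.
have uN w c : u (- w) c = u w c.
  have := asymptotic_normN w (- c); rewrite opprK => e1.
  by rewrite /u e1 asymptotic_normN minC.
have [a0|/ltW a0] := leP 0 a; have [b0|/ltW b0] := leP 0 b.
- rewrite !ger0_norm//; apply: le_trans (asymptotic_norm2_ge_add v a0 b0).
  by rewrite /u ge_min lexx.
- rewrite ger0_norm// ler0_norm// -[b in leRHS]opprK.
  by apply: ge_sub => //; rewrite oppr_ge0.
- rewrite ler0_norm// ger0_norm// -uN -(asymptotic_norm2N v).
  by apply: ge_sub => //; rewrite oppr_ge0.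
- rewrite !ler0_norm// -uN -(asymptotic_norm2N v).
  apply: le_trans (asymptotic_norm2_ge_add _ _ _); rewrite ?oppr_ge0//.
  by rewrite /u ge_min lexx.
Qed.

Lemma step_bound_symmetrized_norm : step_bound x U u Num.norm `[-1, 1]%classic.
Proof.
move=> v a b e _ /andP[b0 _] e0.
have h1 := symmetrized_norm_le v a b.
(* The minimum at [v + a *: x m] requires the bound for [b] and for [- b] alike. *)
have h2 := symmetrized_norm_le v a (- b).
rewrite normrN (ger0_norm b0) in h1 h2.
have l1 : u v (`|a| + b) - e < P2 v a b by lra.
have l2 : u v (`|a| + b) - e < P2 v a (- b) by lra.
near=> m; rewrite {2}/u le_min; apply/andP; split; apply/ltW; near: m.
  by apply: (cvgr_gt (P2 v a b)) => //; exact: asymptotic_norm2_cvg xM _ _ _.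
by apply: (cvgr_gt (P2 v a (- b))) => //; exact: asymptotic_norm2_cvg xM _ _ _.
Unshelve. all: by end_near. Qed.

Lemma symmetrized_norm_lip v v' b b' :
  u v b - u v' b' <= `|v - v'| + M * `|b - b'|.
Proof.
have h1 := asymptotic_norm_lip (FU := FU) xM v v' b b'.
have h2 := asymptotic_norm_lip (FU := FU) xM v v' (- b) (- b').
have E : `|- b - - b'| = `|b - b'| by rewrite -opprD normrN.
rewrite E in h2.
have u1 : u v b <= p v b by rewrite /u ge_min lexx.
have u2 : u v b <= p v (- b) by rewrite /u ge_min lexx orbT.
rewrite {2}/u; case: (leP (p v' b')) => _; lra.
Qed.

End same_sign.

Section weakly_null.
Hypothesis x0 : (x : nat -> weak X) @ U --> (0 : weak X).

(** Weak lower semicontinuity at 0 of the convex function sending [z] to [p (v + a *: z) b]; its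
    Lipschitz constant is taken as |a| + 1 to stay positive when [a] is 0. *)
Lemma asymptotic_norm_le_norm2 v a b : p v b <= P2 v a b.
Proof.
have -> : p v b = p (v + a *: 0) b by rewrite scaler0 addr0.
apply: (@weak_lsc _ _ _ U x 0 (fun z => p (v + a *: z) b) (`|a| + 1)) => //.
- move=> y z t /andP[t0 t1]; have t1' : 0 <= 1 - t by rewrite subr_ge0.
  have pZ r w : 0 <= r -> r * p w b = p (r *: w) (r * b).
    by move=> r0; rewrite (asymptotic_normZ xM) ger0_norm.
  rewrite !pZ//.
  have -> : v + a *: (t *: y + (1 - t) *: z) =
      t *: (v + a *: y) + (1 - t) *: (v + a *: z).
    rewrite !scalerDr addrACA -scalerDl [t + _]addrCA subrr addr0 scale1r.
    by rewrite !scalerA !(mulrC a).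
  have {1}-> : b = t * b + (1 - t) * b by ring.
  exact: asymptotic_normD xM _ _ _ _.
- have h y z : p (v + a *: y) b - p (v + a *: z) b <= (`|a| + 1) * `|y - z|.
    apply: le_trans (asymptotic_norm_lip xM _ _ _ _) _.
    rewrite subrr normr0 mulr0 addr0 opprD addrACA subrr add0r -scalerBr normrZ.
    by rewrite ler_wpM2r// lerDl.
  move=> y z; rewrite ler_norml; have := h y z; have := h z y.
  by rewrite (distrC z); lra.
- exact: asymptotic_norm2_cvg xM _ _ _.
Qed.

Lemma norm_le_asymptotic_norm v b : `|v| <= p v b.
Proof.
have := asymptotic_norm_le_norm2 v b 0.
by rewrite (asymptotic_norm20r xM) (asymptotic_norm0 (FU := FU)).
Qed.

(** With the zero weight nothing is spent along a chain: appending later terms with coefficients in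
    [[-1, 1]] lowers the norm by at most the total error. *)
Lemma step_bound_norm :
  step_bound x U (fun v _ => `|v|) (fun=> 0) `[-1, 1]%classic.
Proof.
move=> v a b e _ _ e0.
have le : `|v| - e < p v a by have := norm_le_asymptotic_norm v a; lra.
near=> m; apply/ltW; near: m.
by apply: (cvgr_gt (p v a)) => //; exact: asymptotic_norm_cvg xM _ _.
Unshelve. all: by end_near. Qed.

Hypothesis same : forall y c, 0 < c ->
  P2 y c c + P2 y (- c) (- c) = p y c + p y (- c).

(** The minus sign turns an upper estimate of [p] into a step bound. The identity and
    [asymptotic_norm_le_norm2] at [(-1, -1)] give [P2 v 1 1 <= p v 1], and convexity between
    [(0, 1)] and [(1, 1)] covers all [a] in [[0, 1]]. *)
Lemma step_bound_oppr_asymptotic_norm :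
  step_bound x U (fun v _ => - p v 1) (fun=> 0) `[0, 1]%classic.
Proof.
move=> v a b e /=; rewrite in_itv/= => a01 _ e0.
have h : P2 v 1 1 <= p v 1.
  have := same v ltr01; have := asymptotic_norm_le_norm2 v (-1) (-1); lra.
have h2 : P2 v a 1 <= p v 1.
  have := asymptotic_norm2_convex v 1 1 0 1 a01.
  rewrite mulr0 addr0 !mulr1 addrCA subrr addr0 (asymptotic_norm20l (FU := FU)).
  case/andP: a01 => a0 _; have := ler_wpM2l a0 h; lra.
have le : P2 v a 1 < p v 1 + e by lra.
have : \forall m \near U, p (v + a *: x m) 1 < p v 1 + e.
  by apply: (cvgr_lt (P2 v a 1)) => //; exact: asymptotic_norm2_cvg xM _ _ _.
by apply: filterS => m; lra.
Qed.

End weakly_null.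

End StepBounds.

(** * Estimates for finite sums along the chosen subsequence *)

Section BasicSequences.
Context {R : realType} {X : normedModType R} (x : nat -> X).
Implicit Types (G : X -> R -> R) (w : R -> R) (S : set R) (phi : nat -> nat).

Definition step_bounded_along G w S (e : R) phi := forall k (a : nat -> R),
  (forall i, `|a i| <= 1) -> forall c b, S c -> 0 <= b <= 1 ->
  G (\sum_(i < k) a i *: x (phi i)) (w c + b) - e * 2^-1 ^+ k.+1 <=
  G (\sum_(i < k) a i *: x (phi i) + c *: x (phi k)) b.

Lemma step_bounded_along_sum G w S e phi (a : nat -> R) k n b : 0 <= e ->
  step_bounded_along G w S e phi -> (k <= n)%N -> (forall i, `|a i| <= 1) ->
  (forall i, (k <= i < n)%N -> S (a i) /\ 0 <= w (a i)) -> 0 <= b ->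
  \sum_(k <= i < n) w (a i) + b <= 1 ->
  G (\sum_(i < k) a i *: x (phi i)) (\sum_(k <= i < n) w (a i) + b) - e <=
  G (\sum_(i < n) a i *: x (phi i)) b.
Proof.
move=> e0 sG kn a1 Sa b0 wb1.
apply: le_trans (@telescoping_lower_bound R
  (fun i => G (\sum_(j < i) a j *: x (phi j))) (w \o a)
  (fun i => e * 2^-1 ^+ i.+1) k n b kn _ b0 wb1 _).
- by rewrite lerD2l lerN2 sum_half_powers_le.
- by move=> i /Sa[].
- move=> i t /Sa[Sai _] t01; rewrite big_ord_recr; exact: sG.
Qed.

Lemma sum_scaled_truncation n (a : nat -> R) (y : nat -> X) (K : R) : K != 0 ->
  \sum_(i < n) (if (i < n)%N then a i / K else 0) *: y i =
  K^-1 *: \sum_(i < n) a i *: y i.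
Proof.
by move=> K0; rewrite scaler_sumr; apply: eq_bigr => i _;
  rewrite ltn_ord scalerA mulrC.
Qed.

Context (U : set_system nat) {FU : UltraFilter U} (Uoo : U `=>` \oo) (M : R).
Hypotheses (M0 : 0 < M) (xM : forall n, `|x n| <= M).

Local Notation p := (asymptotic_norm U x).
Local Notation u := (symmetrized_norm U x).

Hypothesis s0 : 0 < p 0 1.

(** After scaling so that the |a i| sum to 1, the chain starts at the zero vector with second
    argument 1 and ends with second argument 0: the norm of the sum is at least [p 0 1] minus the
    total error. *)
Lemma l1_lower_estimate : step_bound x U u Num.norm `[-1, 1]%classic ->
  exists2 phi : nat -> nat, increasing_seq phi & forall n (a : nat -> R),
    p 0 1 / 2 * \sum_(i < n) `|a i| <= `|\sum_(i < n) a i *: x (phi i)|.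
Proof.
(* The total error is half of [p 0 1], which leaves the other half as the lower constant. *)
move=> su; pose e := p 0 1 / 2.
have e0 : 0 < e by rewrite divr_gt0.
have ek k : 0 < e * 2^-1 ^+ k.+1 by rewrite mulr_gt0// exprn_gt0.
have [phi phii Hphi] := @select_subsequence R X x U _ (fun k v m =>
    forall c b, `[-1, 1]%classic c -> 0 <= b <= 1 ->
    u v (`|c| + b) - e * 2^-1 ^+ k.+1 <= u (v + c *: x m) b) Uoo (fun k K cK =>
  step_bound_uniform su cK (@segment_compact R (-1) 1) M0 xM
    (symmetrized_norm_lip xM) (@ler_dist_dist R R^o)
    (ek k)).
exists phi => // n a; set K := \sum_(i < n) `|a i|.
have [K0|K0] := eqVneq K 0; first by rewrite K0 mulr0.
have Kge : 0 <= K by exact: sumr_ge0.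
have {}K0' : 0 < K by rewrite lt_neqAle eq_sym K0.
(* Zero beyond [n], since the selected estimates ask for coefficients of absolute value at most 1 at
   every index. *)
pose a' i := if (i < n)%N then a i / K else 0.
have a'1 i : `|a' i| <= 1.
  rewrite /a'; case: ifP => [ni|_]; last by rewrite normr0.
  rewrite normrM normfV (gtr0_norm K0') ler_pdivrMr// mul1r /K.
  by rewrite (bigD1 (Ordinal ni))//= lerDl sumr_ge0.
have wE : \sum_(0 <= i < n) `|a' i| + 0 = 1.
  rewrite addr0 big_mkord -[RHS](mulfV K0) /K mulr_suml.
  by apply: eq_bigr => i _; rewrite /a' ltn_ord normrM normfV (gtr0_norm K0').
have := @step_bounded_along_sum u Num.norm `[-1, 1]%classic e phi a' 0 n 0 (ltW e0)
  Hphi (leq0n n) a'1 _ (lexx 0); rewrite wE => /(_ _ (lexx _)) H.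
have {}H : u 0 1 - e <= u (\sum_(i < n) a' i *: x (phi i)) 0.
  rewrite big_ord0 in H; apply: H => i _; split=> //.
  by rewrite /= in_itv/= -ler_norml.
have u01 : u 0 1 = p 0 1.
  by rewrite /symmetrized_norm -(asymptotic_normN xM 0 (-1)) oppr0 opprK minxx.
move: H; rewrite u01 /symmetrized_norm oppr0 (asymptotic_norm0 (FU := FU)) minxx.
have -> : \sum_(i < n) a' i *: x (phi i) = K^-1 *: \sum_(i < n) a i *: x (phi i).
  exact: (sum_scaled_truncation n a (x \o phi) K0).
rewrite normrZ normfV (gtr0_norm K0').
rewrite mulrC ler_pdivlMr// /e; lra.
Qed.

(** The first step bound makes the norms of partial sums almost nondecreasing, which controls single
    terms by the whole sum; the second bounds sums with coefficients in [[0, 1]] by [p 0 1] plus the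
    error. *)
Lemma c0_estimates :
  step_bound x U (fun v _ => `|v|) (fun=> 0) `[-1, 1]%classic ->
  step_bound x U (fun v _ => - p v 1) (fun=> 0) `[0, 1]%classic ->
  (forall v, `|v| <= p v 1) ->
  exists2 phi : nat -> nat, increasing_seq phi & forall n (a : nat -> R) K,
    0 < K -> (forall i, (i < n)%N -> `|a i| <= K) ->
    `|\sum_(i < n) a i *: x (phi i)| <= 4 * p 0 1 * K /\
    forall k, (k < n)%N ->
      3 / 8 * p 0 1 * `|a k| <= `|\sum_(i < n) a i *: x (phi i)| + p 0 1 / 8 * K.
Proof.
move=> sl su vp; pose e := p 0 1 / 8.
have e0 : 0 < e by rewrite divr_gt0.
have ek k : 0 < e * 2^-1 ^+ k.+1 by rewrite mulr_gt0// exprn_gt0.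
have lip0 (a a' : R) : `|0 - 0 : R| <= `|a - a'| by rewrite subr0 normr0.
have big_x : \forall m \near U, 3 / 4 * p 0 1 < `|0 + 1 *: x m|.
  apply: (cvgr_gt (p 0 1)); last by move: s0; lra.
  exact: asymptotic_norm_cvg xM _ _.
have lipl (v v' : X) (b b' : R) : `|v| - `|v'| <= `|v - v'| + M * `|b - b'|.
  by apply: (le_trans (lerB_dist _ _)); rewrite lerDl mulr_ge0// ltW.
have lipu (v v' : X) (b b' : R) :
    - p v 1 - - p v' 1 <= `|v - v'| + M * `|b - b'|.
  have := asymptotic_norm_lip (FU := FU) xM v' v 1 1.
  rewrite subrr normr0 mulr0 addr0 distrC opprK addrC => /le_trans; apply.
  by rewrite lerDl mulr_ge0// ltW.
pose Q k (v : X) m := [/\ forall c b : R, `[-1, 1]%classic c -> 0 <= b <= 1 ->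
      `|v| - e * 2^-1 ^+ k.+1 <= `|v + c *: x m|,
    forall c b : R, `[0, 1]%classic c -> 0 <= b <= 1 ->
      - p v 1 - e * 2^-1 ^+ k.+1 <= - p (v + c *: x m) 1 &
    3 / 4 * p 0 1 <= `|x m|].
have sel k K : compact K -> \forall m \near U, forall v, K v -> Q k v m.
  move=> cK.
  have H1 := step_bound_uniform sl cK (@segment_compact R (-1) 1) M0 xM lipl lip0 (ek k).
  have H2 := step_bound_uniform su cK (@segment_compact R 0 1) M0 xM lipu lip0 (ek k).
  near=> m => v Kv; split; last first.
  - by near: m; apply: filterS big_x => m; rewrite add0r scale1r => /ltW.
  - by move=> c b; move: v Kv c b; near: m; exact: H2.
  - by move=> c b; move: v Kv c b; near: m; exact: H1.
have [phi phii Hphi] := select_subsequence x Uoo sel.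
exists phi => // n a K K0 aK.
pose V (b : nat -> R) k := \sum_(i < k) b i *: x (phi i).
have lo (b : nat -> R) k : (forall i, `|b i| <= 1) -> (k <= n)%N ->
    `|V b k| - e <= `|V b n|.
  move=> b1 kn; apply: (@step_bounded_along_sum (fun v _ => `|v|) (fun=> 0)
    `[-1, 1]%classic e phi b k n 0 (ltW e0) _ kn b1 _ (lexx 0)).
  - by move=> j c c1; have [h _ _] := Hphi j c c1.
  - by move=> i _; rewrite /= in_itv/= -ler_norml.
  - by rewrite big1// addr0.
have up (b : nat -> R) : (forall i, 0 <= b i <= 1) -> `|V b n| <= p 0 1 + e.
  move=> b01; have b1 i : `|b i| <= 1 by have /andP[b0 ?] := b01 i; rewrite ger0_norm.
  have := @step_bounded_along_sum (fun v _ => - p v 1) (fun=> 0)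
    `[0, 1]%classic e phi b 0 n 0 (ltW e0) _ (leq0n n) b1 _ (lexx 0) _.
  rewrite big_ord0 => H; have := vp (V b n); have : - p 0 1 - e <= - p (V b n) 1.
    apply: H => [j c c1|i _|]; [by have [_ h _] := Hphi j c c1| |].
      by rewrite /= in_itv/=.
    by rewrite big1// addr0.
  lra.
pose a' i := if (i < n)%N then a i / K else 0.
have a'1 i : `|a' i| <= 1.
  rewrite /a'; case: ifP => [ni|_]; last by rewrite normr0.
  by rewrite normrM normfV (gtr0_norm K0) ler_pdivrMr// mul1r aK.
have Va : V a' n = K^-1 *: \sum_(i < n) a i *: x (phi i).
  exact: (sum_scaled_truncation n a (x \o phi) (lt0r_neq0 K0)).
have nVa : `|V a' n| * K = `|\sum_(i < n) a i *: x (phi i)|.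
  by rewrite Va normrZ normfV (gtr0_norm K0) mulrAC mulVf ?mul1r// gt_eqF.
split.
  (* The upper bound is available for coefficients in [[0, 1]] only, so positive and negative parts
     are treated separately; twice [p 0 1 + e] is below [4 * p 0 1]. *)
  have Vd : V a' n = V (fun i => Num.max (a' i) 0) n - V (fun i => Num.max (- a' i) 0) n.
    rewrite /V -sumrB; apply: eq_bigr => i _; rewrite -scalerBl; congr (_ *: _).
    by have [|] := leP (a' i) 0; have [|] := leP (- a' i) 0; lra.
  have h1 := up (fun i => Num.max (a' i) 0) _.
  have h2 := up (fun i => Num.max (- a' i) 0) _.
  have : `|V a' n| <= 4 * p 0 1.
    rewrite Vd; apply: (le_trans (ler_normB _ _)).
    have {}h1 := h1 _; have {}h2 := h2 _.
    apply: (@le_trans _ _ ((p 0 1 + e) + (p 0 1 + e))); last by rewrite /e; move: s0; lra.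
    apply: lerD; [apply: h1|apply: h2] => i; have := a'1 i; rewrite ler_norml.
      by have [|] := leP (a' i) 0; lra.
    by have [|] := leP (- a' i) 0; lra.
  by move=> h; rewrite -nVa ler_pM2r.
move=> k kn; have [_ _ xk] := Hphi k a' a'1.
have lk := lo a' k a'1 (ltnW kn); have lk1 := lo a' k.+1 a'1 kn.
(* A term is the difference of two successive partial sums, each of norm at most [|V a' n| + e]. As
   [|x (phi k)|] is at least [3 / 4 * p 0 1], halving gives the factor [3 / 8]. *)
have Vk : a' k *: x (phi k) = V a' k.+1 - V a' k.
  by rewrite /V big_ord_recr /= addrAC subrr add0r.
have : `|a' k| * `|x (phi k)| <= `|V a' k.+1| + `|V a' k|.
  by rewrite -normrZ Vk ler_normB.
have := ler_wpM2l (normr_ge0 (a' k)) xk.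
have -> : `|a' k| = `|a k| / K by rewrite /a' kn normrM normfV (gtr0_norm K0).
move=> h1 h2; have : 3 / 8 * p 0 1 * (`|a k| / K) <= `|V a' n| + e by lra.
move=> /(ler_wpM2r (ltW K0)); rewrite [(_ + e) * K]mulrDl nVa -[_ * (_ / K) * K]mulrA.
by rewrite (mulfVK (lt0r_neq0 K0)).
Unshelve. all: by end_near. Qed.

End BasicSequences.

(** * Comparison with the unit vector bases of l_1 and c_0 *)

Section UnitVectorBases.
Context {R : realType}.

Lemma sum_unit_vector n (a : nat -> R) k :
  (\sum_(i < n) a i *: @unit_vector R i) k = if (k < n)%N then a k else 0.
Proof.
have E (i : 'I_n) : (a i *: @unit_vector R i) k = a i * (k == i)%:R by [].
rewrite fct_sumE (eq_bigr _ (fun i _ => E i)); case: ifP => kn.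
  rewrite (bigD1 (Ordinal kn))//= eqxx mulr1 big1 ?addr0// => i ik.
  by rewrite -val_eqE /= eq_sym in ik; rewrite (negbTE ik) mulr0.
rewrite big1// => i _; case: eqP kn => [->|_ _]; last by rewrite mulr0.
by rewrite ltn_ord.
Qed.

Lemma l1_norm_sum_unit_vector n (a : nat -> R) :
  l1_norm (\sum_(i < n) a i *: @unit_vector R i) = \sum_(i < n) `|a i|.
Proof.
apply: lim_near_cst => //; near=> N.
have nN : (n <= N)%N by near: N; exists n.
rewrite seriesEnat /= (big_cat_nat _ nN)//= [X in _ + X]big_nat_cond.
rewrite [X in _ + X]big1 ?addr0 => [|i /andP[/andP[ni _] _]].
  rewrite big_mkord; apply: eq_bigr => i _.
  by rewrite sum_unit_vector ltn_ord.
by rewrite sum_unit_vector ltnNge ni normr0.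
Unshelve. all: by end_near. Qed.

Lemma c0_norm_bounds n (a : nat -> R) C :
  (forall i, (i < n)%N -> `|a i| <= C) -> 0 <= C ->
  c0_norm (\sum_(i < n) a i *: @unit_vector R i) <= C.
Proof.
move=> aC C0; apply: ge_sup; first by eexists; exists 0.
move=> _ [k _ <-]; rewrite sum_unit_vector.
by case: ifP => [/aC//|_]; rewrite normr0.
Qed.

Lemma ler_c0_norm n (a : nat -> R) k :
  `|(\sum_(i < n) a i *: @unit_vector R i) k| <=
  c0_norm (\sum_(i < n) a i *: @unit_vector R i).
Proof.
apply: ub_le_sup; last by exists k.
exists (\sum_(j < n) `|a j|) => _ [j _ <-]; rewrite sum_unit_vector.
case: ifP => [jn|_]; last by rewrite normr0 sumr_ge0.
by rewrite (bigD1 (Ordinal jn))//= lerDl sumr_ge0.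
Qed.

Lemma equivalent_to_l1_basisP (X : normedModType R) (y : nat -> X) M c :
  0 < M -> 0 < c -> (forall n, `|y n| <= M) ->
  (forall n (a : nat -> R), c * \sum_(i < n) `|a i| <= `|\sum_(i < n) a i *: y i|) ->
  equivalent_to_l1_basis y.
Proof.
move=> M0 c0 yM yc; exists M, c^-1; split; rewrite ?invr_gt0// => n a.
rewrite l1_norm_sum_unit_vector; apply/andP; split; last first.
  by rewrite mulrC ler_pdivlMr// mulrC.
rewrite mulrC ler_pdivrMr// mulr_suml; apply: (le_trans (ler_norm_sum _ _ _)).
by apply: ler_sum => i _; rewrite normrZ ler_wpM2l.
Qed.

(** With [K] the c_0 norm and the supremum taken over [k], the lower estimate reads
    [3 / 8 * s * K <= |w| + s / 8 * K]. Absorbing the last term leaves [s / 4 * K <= |w|], hence the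
    constant [4 / s]. *)
Lemma equivalent_to_c0_basisP (X : normedModType R) (y : nat -> X) s :
  0 < s -> (forall n (a : nat -> R) K, 0 < K -> (forall i, (i < n)%N -> `|a i| <= K) ->
    `|\sum_(i < n) a i *: y i| <= 4 * s * K /\
    forall k, (k < n)%N ->
      3 / 8 * s * `|a k| <= `|\sum_(i < n) a i *: y i| + s / 8 * K) ->
  equivalent_to_c0_basis y.
Proof.
move=> s0 H; have s40 : 0 < 4 * s by rewrite mulr_gt0.
exists (4 * s), (4 / s); split; rewrite ?divr_gt0// => n a.
set K := c0_norm _; set w := \sum_(i < n) _.
have aK i : (i < n)%N -> `|a i| <= K.
  by move=> ni; have := ler_c0_norm n a i; rewrite sum_unit_vector ni.
have K0 : 0 <= K by exact: le_trans (ler_c0_norm n a 0).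
have [KE|Kn] := eqVneq K 0.
  have -> : w = 0.
    rewrite /w big1// => i _; have := aK i (ltn_ord i).
    by rewrite KE normr_le0 => /eqP->; rewrite scale0r.
  by rewrite normr0 !mulr0 KE lexx.
have {Kn}K0 : 0 < K by rewrite lt_neqAle eq_sym Kn.
have [up lo] := H n a K K0 aK; apply/andP; split.
  by rewrite mulrC ler_pdivrMr// mulrC.
have : K <= (`|w| + s / 8 * K) / (3 / 8 * s).
  apply: c0_norm_bounds => [i ni|].
    by rewrite ler_pdivlMr ?mulr_gt0// mulrC; exact: lo.
  by rewrite divr_ge0// ?addr_ge0 ?mulr_ge0// ltW.
rewrite ler_pdivlMr ?mulr_gt0// => h.
by rewrite mulrAC ler_pdivlMr//; move: h; lra.
Qed.

End UnitVectorBases.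

(** * Norm convergence along an ultrafilter for relatively weakly compact sequences *)

Section WeaklyCompact.
Context {R : realType} {X : completeNormedModType R}.

Lemma sum_pad (V : nmodType) (F : nat -> V) n N : (n <= N)%N ->
  (forall i, (n <= i)%N -> F i = 0) -> \sum_(i < N) F i = \sum_(i < n) F i.
Proof.
move=> nN F0; rewrite -!(big_mkord xpredT F) (big_cat_nat _ nN)//=.
rewrite [X in _ + X]big_nat_cond [X in _ + X]big1 ?addr0// => i.
by case/andP => /andP[/F0].
Qed.

(** The coefficients form a sequence on all naturals, vanishing outside [[k, n)], so that
    combinations of different lengths can be added termwise. *)
Definition convex_tail (y : nat -> X) k : set X := [set z | exists n (a : nat -> R),
  [/\ (k <= n)%N, forall i, 0 <= a i,
      (forall i, (i < k)%N -> a i = 0) /\ (forall i, (n <= i)%N -> a i = 0),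
      \sum_(i < n) a i = 1 & z = \sum_(i < n) a i *: y i]].

Lemma segment_closed_convex_tail y k : segment_closed (convex_tail y k).
Proof.
move=> _ _ t [n [a [kn a0 [ak an] a1 ->]]] [m [b [km b0 [bk bm] b1 ->]]].
move=> /andP[t0 t1]; have t1' : 0 <= 1 - t by rewrite subr_ge0.
exists (maxn n m), (fun i => t * a i + (1 - t) * b i); split.
- by rewrite leq_max kn.
- by move=> i; rewrite addr_ge0// mulr_ge0.
- split=> i; first by move=> ik; rewrite ak// bk// !mulr0 addr0.
  by rewrite geq_max => /andP[ni mi]; rewrite an// bm// !mulr0 addr0.
- rewrite big_split/= -!mulr_sumr (@sum_pad R a n)//= ?leq_maxl//.
  by rewrite (@sum_pad R b m)//= ?leq_maxr// a1 b1 !mulr1 addrC subrK.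
- rewrite -(@sum_pad X (fun i => a i *: y i) n (maxn n m)) ?leq_maxl//; last first.
    by move=> i ni; rewrite an// scale0r.
  rewrite -(@sum_pad X (fun i => b i *: y i) m (maxn n m)) ?leq_maxr//; last first.
    by move=> i ni; rewrite bm// scale0r.
  rewrite !scaler_sumr -big_split /=; apply: eq_bigr => i _.
  by rewrite !scalerA -scalerDl.
Qed.

Lemma convex_tail_term y k j : (k <= j)%N -> convex_tail y k (y j).
Proof.
move=> kj; exists j.+1, (fun i => (i == j)%:R); split.
- exact: leqW.
- by move=> i; exact: ler0n.
- split=> i ij; first by rewrite (ltn_eqF (leq_trans ij kj)).
  by rewrite gtn_eqF.
- rewrite big_ord_recr /= eqxx big1 ?add0r// => i _.
  by rewrite (ltn_eqF (ltn_ord i)).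
- rewrite big_ord_recr /= eqxx scale1r big1 ?add0r// => i _.
  by rewrite (ltn_eqF (ltn_ord i)) scale0r.
Qed.

Lemma coef_le1 n (a : nat -> R) i : (forall i, 0 <= a i) ->
  (forall i, (n <= i)%N -> a i = 0) -> \sum_(i < n) a i = 1 -> a i <= 1.
Proof.
move=> a0 an <-; have [ni|ni] := leqP n i; first by rewrite an// sumr_ge0.
by rewrite (bigD1 (Ordinal ni))//= lerDl sumr_ge0.
Qed.

Context (U : set_system nat) {FU : UltraFilter U} (Uoo : U `=>` \oo).
Context (x : nat -> X) (M : R).
Hypotheses (M0 : 0 < M) (xM : forall n, `|x n| <= M).

Local Notation p := (asymptotic_norm U x).

(** Compactness in its ultrafilter form gives the limit along [U] itself, so [phi] need not be
    thinned out further. *)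
Lemma subsequence_weak_limit (phi : nat -> nat) : relatively_weakly_compact x ->
  exists y : X, (x \o phi : nat -> weak X) @ U --> (y : weak X).
Proof.
rewrite /relatively_weakly_compact precompactE compact_ultra => cx.
have [|y [_ xy]] := cx _ (ultra_fmap (x \o phi : nat -> weak X) FU).
  by apply: nearW => n; apply: subset_closure; exists (phi n).
by exists y.
Qed.

(* The point [z] is a convex combination of the chosen subsequence, near its weak
   cluster point [y]; by Mazur some convex combination [z'] of the rest of the
   subsequence is also near [y], so [p (- z) 1 - e <= |z' - z|] is small. *)
Lemma step_bound_cluster : step_bound x U p id `[0, 1]%classic ->
  relatively_weakly_compact x -> forall e, 0 < e -> exists z, p (- z) 1 <= 3 * e.
Proof.
move=> sp rwc e e0.
have ek k : 0 < e * 2^-1 ^+ k.+1 by rewrite mulr_gt0// exprn_gt0.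
have lip1 (a a' : R) : `|id a - id a'| <= `|a - a'| by [].
have [phi phii Hphi] := @select_subsequence R X x U _ (fun k v m =>
    forall c b, `[0, 1]%classic c -> 0 <= b <= 1 ->
    p v (c + b) - e * 2^-1 ^+ k.+1 <= p (v + c *: x m) b) Uoo (fun k K cK =>
  step_bound_uniform sp cK (@segment_compact R 0 1) M0 xM
    (asymptotic_norm_lip xM) lip1 (ek k)).
have [y xy] := subsequence_weak_limit phi rwc.
have near_y k : exists2 z, convex_tail (x \o phi) k z & `|z - y| < e.
  apply: mazur => //; first exact: segment_closed_convex_tail.
  move=> f cf d d0; have fxy := weak_cvg _ cf xy.
  have H1 : \forall n \near U, f ((x \o phi) n) < f y + d.
    by apply: (cvgr_lt (f y)); [exact: fxy|rewrite ltrDl].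
  have H2 : \forall n \near U, (k <= n)%N by apply: Uoo; exists k.
  have [n [fn kn]] := filter_ex (filterI H1 H2).
  by exists ((x \o phi) n) => //; exact: convex_tail_term.
have [z [k [a [_ a0 [_ ak] a1 zE]]] zy] := near_y 0%N.
have [z' [n [b [kn b0 [bk bn] b1 z'E]]] z'y] := near_y k.
(* The partial sum up to [k] is [- z], while the coefficients from [k] on are nonnegative with sum
   1, exactly the weight that the chain may spend. *)
exists z; pose c i := if (i < k)%N then - a i else b i.
have c1 i : `|c i| <= 1.
  rewrite /c; case: ifP => _; rewrite ?normrN ger0_norm//.
    exact: coef_le1 ak a1.
  exact: coef_le1 bn b1.
have sumk : \sum_(i < k) c i *: x (phi i) = - z.
  rewrite zE -sumrN; apply: eq_bigr => i _; rewrite /c ltn_ord scaleNr.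
  by [].
have sumn : \sum_(i < n) c i *: x (phi i) = z' - z.
  have -> : z = \sum_(i < n) a i *: x (phi i).
    rewrite zE (@sum_pad X (fun i => a i *: x (phi i)) k n)// => i ki.
    by rewrite ak// scale0r.
  rewrite z'E -sumrB; apply: eq_bigr => i _; rewrite /c /= -scalerBl.
  by case: ltnP => ik; [rewrite bk// sub0r|rewrite ak// subr0].
have sumc : \sum_(k <= i < n) c i = 1.
  have -> : \sum_(k <= i < n) c i = \sum_(k <= i < n) b i.
    by apply: eq_big_nat => i /andP[ki _]; rewrite /c ltnNge ki.
  rewrite -b1 -(big_mkord xpredT b) [RHS](big_cat_nat (leq0n k) kn)/=.
  by rewrite [X in X + _]big_nat_cond [X in X + _]big1 ?add0r// => i /andP[/andP[_ /bk]].
have := @step_bounded_along_sum R X x p id `[0, 1]%classic e phi c k n 0 (ltW e0)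
  Hphi kn c1 _ (lexx 0).
rewrite /= addr0 sumc => /(_ _ (lexx 1)) H.
have {}H : p (- z) 1 - e <= `|z' - z|.
  rewrite -(asymptotic_norm0 (FU := FU) x) -sumn -sumk; apply: H => i /andP[ki _].
  by rewrite /c ltnNge ki /= b0 in_itv/= b0 (coef_le1 _ b0 bn b1).
have := ler_distD y z' z; rewrite (distrC y); lra.
Qed.

(** [step_bound_cluster] at [e / 4] gives a [z] with [p (- z) 1 < e], so almost all [x n] along [U]
    lie within [e] of [z]; the image filter is Cauchy and [X] is complete. *)
Lemma step_bound_cvg : step_bound x U p id `[0, 1]%classic ->
  relatively_weakly_compact x -> cvg (x @ U).
Proof.
move=> sp rwc; apply/cauchy_cvgP; apply: cauchy_exP => e e0.
have [z pz] := step_bound_cluster sp rwc (divr_gt0 e0 (ltr0Sn R 3)).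
have H : \forall n \near U, `| - z + 1 *: x n| < e.
  apply: (cvgr_lt (p (- z) 1)); last by move: e0 pz; lra.
  exact: asymptotic_norm_cvg xM _ _.
exists z; apply: filterS H => n; rewrite -ball_normE /=.
by rewrite scale1r distrC addrC.
Qed.

End WeaklyCompact.

(** * Strict convexity and the three properties of the norm *)

Section Properties.
Context {R : realType} {X : completeNormedModType R}.
Variables (d : nat -> X) (N : X -> R).
Hypotheses (d0 : d 0 = 0)
  (dense_d : forall y e, 0 < e -> exists k, `|d k - y| < e)
  (normN : is_norm N) (N2 : forall y, `|y| <= N y <= 2 * `|y|)
  (splitN : forall k, exists c tau, [/\ 0 < c, seminorm tau &
    forall y, N y = c * two_norm (d k) y + tau y]).

Let N0 : N 0 = 0.
Proof. by have [_ NZ _] := normN; rewrite -(scale0r 0) NZ normr0 mul0r. Qed.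

Let leN y : `|y| <= N y.
Proof. by have /andP[] := N2 y. Qed.

Lemma two_norm_additive x y k : N (x + y) = N x + N y ->
  two_norm (d k) (x + y) = two_norm (d k) x + two_norm (d k) y.
Proof.
have [c [tau [c0 [_ st] Nst]]] := splitN k; rewrite !Nst => E.
have [_ sd] := seminorm_two_norm (d k).
apply/eqP; rewrite eq_le sd /= -subr_ge0 -(pmulr_rge0 _ c0).
have := st x y; move: E; lra.
Qed.

(** Equality for all the [two_norm (d k)] makes [x] and [y] multiples of a single vector [q]; equal
    norms then make the multiples equal. *)
Lemma renorming_eq x y : N x = N y -> N (x + y) = N x + N y -> x = y.
Proof.
have [Ninj NZ _] := normN; move=> Nxy ND.
have [Nx0|Nx0] := eqVneq (N x) 0.
  by rewrite (Ninj _ Nx0) (Ninj y)// -Nxy.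
have pos (z : X) : N z != 0 -> 0 < `|z|.
  by rewrite normr_gt0; apply: contraNneq => ->; rewrite N0.
pose s := `|x|; pose t := `|y|.
have s0 : 0 < s by exact: pos.
have t0 : 0 < t by apply: pos; rewrite -Nxy.
have sD : `|x + y| = s + t.
  have := two_norm_additive 0 ND; rewrite d0 !two_norm0 /s /t; lra.
have st0 : 0 < s + t by exact: addr_gt0.
(* For [d k] near [q], [(s + t) *: d k + (x + y)] is almost zero. Since the terms with minus signs
   satisfy the triangle inequality on their own, equality for [two_norm (d k)] forces [s *: d k + x]
   and [t *: d k + y] to be almost zero too. *)
pose q := - ((s + t)^-1 *: (x + y)).
have key e : 0 < e -> `|s *: q + x| <= 2 * (s + t) * e /\
    `|t *: q + y| <= 2 * (s + t) * e.
  move=> e0; have [k dk] := dense_d q e0.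
  have := two_norm_additive k ND; rewrite /two_norm sD -/s -/t => E.
  have := ler_normD (s *: d k - x) (t *: d k - y).
  rewrite addrACA -opprD -scalerDl => h1.
  have h2 : `|(s + t) *: d k + (x + y)| <= (s + t) * e.
    have -> : (s + t) *: d k + (x + y) = (s + t) *: (d k - q).
      by rewrite /q opprK scalerDr scalerA mulfV ?gt_eqF// scale1r.
    by rewrite normrZ gtr0_norm// ler_pM2l// ltW.
  have h3 (r : R) (z : X) : 0 < r -> `|r *: q + z| <= r * e + `|r *: d k + z|.
    move=> r0; have -> : r *: q + z = r *: (q - d k) + (r *: d k + z).
      by rewrite addrA scalerBr subrK.
    apply: (le_trans (ler_normD _ _)); rewrite lerD2r normrZ gtr0_norm//.
    by rewrite ler_pM2l// distrC ltW.
  have := h3 s x s0; have := h3 t y t0.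
  have := normr_ge0 (s *: d k + x); have := normr_ge0 (t *: d k + y).
  have := mulr_gt0 s0 e0; have := mulr_gt0 t0 e0.
  move: E h1 h2; set n1 := `|_ + (x + y)|; set n2 := `|_ - (x + y)|; lra.
have zero (z : X) : (forall e, 0 < e -> `|z| <= 2 * (s + t) * e) -> z = 0.
  move=> H; apply/normr0_eq0/eqP; rewrite eq_le normr_ge0 andbT; apply/ler_addgt0Pr => e e0.
  have st20 : 0 < 2 * (s + t) by rewrite mulr_gt0.
  have := H _ (divr_gt0 e0 st20).
  by rewrite add0r mulrC mulfVK// gt_eqF.
have /eqP := zero _ (fun e e0 => (key e e0).1); rewrite addrC addr_eq0 => /eqP xq.
have /eqP := zero _ (fun e e0 => (key e e0).2); rewrite addrC addr_eq0 => /eqP yq.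
have Nq : N q != 0.
  by apply: contraNneq Nx0 => /Ninj q0; rewrite xq q0 scaler0 oppr0 N0.
have NN z : N (- z) = N z by rewrite -scaleN1r NZ normrN1 mul1r.
move: Nxy; rewrite xq yq !NN !NZ !gtr0_norm// => /(mulIf Nq) ->.
by [].
Qed.

Lemma renorming_strictly_convex : strictly_convex N.
Proof.
by move=> x y Nx Ny Nxy; apply: renorming_eq; rewrite ?Nxy Nx Ny//; ring.
Qed.

Lemma renorming_equivalent : equivalent_norm N.
Proof. by split=> //; exists 1, 2; split=> // y; rewrite mul1r. Qed.

Lemma norm_bounded (x : nat -> X) (l : R) : N (x n) @[n --> \oo] --> l ->
  exists2 M, 0 < M & forall n, `|x n| <= M.
Proof.
move=> /cvgP/cvg_seq_bounded/pinfty_ex_gt0[M M0 NM]; exists M => // n.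
apply: (le_trans (leN _)); apply: (le_trans (ler_norm _)); exact: NM.
Qed.

Section ultrafilter.
Context (U : set_system nat) {FU : UltraFilter U} (Uoo : U `=>` \oo).
Context (x : nat -> X) (M l : R).
Hypotheses (M0 : 0 < M) (xM : forall n, `|x n| <= M).
Hypotheses (Nl : N (x n) @[n --> \oo] --> l) (l0 : 0 < l).

Local Notation p := (asymptotic_norm U x).
Local Notation P2 := (asymptotic_norm2 U x).

Lemma cvg_ultra (f : nat -> R) (r : R) : f @ \oo --> r -> f @ U --> r.
Proof. by move=> fr A /fr/Uoo. Qed.

Let ulim1E : ulim1 U x N = l.
Proof. exact/ulimE/cvg_ultra. Qed.

Lemma iterated_lim_ulim2 eps r :
  iterated_lim (fun m n => N (x m + eps *: x n)) r -> ulim2 U x eps N = r.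
Proof.
move=> [g fg gr]; apply: ulimE.
have -> : (fun m => ulim U (fun n => N (x m + eps *: x n))) = g.
  by apply/funext => m; apply: ulimE; apply: cvg_ultra; exact: fg.
exact: cvg_ultra.
Qed.

Let iterated_lim_add r : iterated_lim (fun m n => N (x m + x n)) r ->
  ulim2 U x 1 N = r.
Proof.
by move=> [g fg gr]; apply: iterated_lim_ulim2; exists g => // m;
  under eq_fun do rewrite scale1r; exact: fg.
Qed.

Let iterated_lim_sub r : iterated_lim (fun m n => N (x m - x n)) r ->
  ulim2 U x (-1) N = r.
Proof.
by move=> [g fg gr]; apply: iterated_lim_ulim2; exists g => // m;
  under eq_fun do rewrite scaleN1r; exact: fg.
Qed.

Let limN0 : 0 < ulim1 U x N. Proof. by rewrite ulim1E. Qed.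

Lemma asymptotic_norm_pos : 0 < p 0 1.
Proof. exact (asymptotic_norm_gt0 xM normN N2 limN0). Qed.

Lemma same_sign_identity : iterated_lim (fun m n => N (x m + x n)) (2 * l) ->
  forall y c, 0 < c ->
  P2 y c c + P2 y (- c) (- c) = p y (c * 2) + p y (- (c * 2)).
Proof.
move=> /iterated_lim_add H y c c0.
have := @asymptotic_identity _ _ _ FU x M xM d N 1 2 d0 dense_d normN N2 splitN _
  (ltr0Sn R 1) limN0 _ y c c0; rewrite mulr1; apply; last by rewrite H ulim1E.
by left=> rho br; apply: (ulim2_le xM br); rewrite normr1.
Qed.

Lemma opposite_sign_identity : iterated_lim (fun m n => N (x m - x n)) (2 * l) ->
  forall y c, 0 < c ->
  P2 y c (- c) + P2 y (- c) c = p y (c * 2) + p y (- (c * 2)).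
Proof.
move=> /iterated_lim_sub H y c c0.
have := @asymptotic_identity _ _ _ FU x M xM d N (-1) 2 d0 dense_d normN N2 splitN _
  (ltr0Sn R 1) limN0 _ y c c0; rewrite mulrN1 opprK; apply; last by rewrite H ulim1E.
by left=> rho br; apply: (ulim2_le xM br); rewrite normrN1.
Qed.

Lemma weakly_null_identity : (x : nat -> weak X) @ U --> (0 : weak X) ->
  iterated_lim (fun m n => N (x m + x n)) l -> forall y c, 0 < c ->
  P2 y c c + P2 y (- c) (- c) = p y c + p y (- c).
Proof.
move=> x0 /iterated_lim_add H y c c0.
have := @asymptotic_identity _ _ _ FU x M xM d N 1 1 d0 dense_d normN N2 splitN _
  ltr01 limN0 _ y c c0; rewrite mulr1; apply; last by rewrite H ulim1E mul1r.
by right=> rho br; rewrite mul1r; exact: (ulim1_le_ulim2 xM x0 br).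
Qed.

End ultrafilter.

(** The trace on [A] of the filter at infinity is proper because [A] is infinite, and any
    ultrafilter above it will do. The full set gives a plain free ultrafilter; a set of bad indices
    serves to test convergence. *)
Lemma exists_ultrafilter (A : set nat) : ~ (\forall n \near \oo, ~ A n) ->
  exists2 U : set_system nat, UltraFilter U & U `=>` \oo /\ U A.
Proof.
move=> nA.
have PF : ProperFilter (within A \oo).
  split; last exact: (within_filter A eventually_filter).
  by move=> H; apply: nA; exact: H.
have [U [FU WU]] := ultraFilterLemma PF.
exists U => //; split; last by apply: WU; exact: nearW.
by move=> B HB; apply: WU; apply: filterS HB.
Qed.

Lemma cvg_of_ultrafilters (x : nat -> X) (y : X) :
  (forall U : set_system nat, UltraFilter U -> U `=>` \oo -> x @ U --> y) ->
  x @ \oo --> y.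
Proof.
move=> H; apply/cvgrPdist_lt => e e0; apply: contrapT => ne.
have [|U FU [Uoo UA]] := exists_ultrafilter (A := [set n | e <= `|y - x n|]).
  by apply: contra_not ne; apply: filterS => n /=; rewrite ltNge => /negP.
have /cvgrPdist_lt/(_ _ e0) xe := H U FU Uoo.
by have [n /= [+ en]] := filter_ex (filterI xe UA); rewrite ltNge en.
Qed.

Lemma N_cvg (U : set_system nat) (FU : UltraFilter U) (x : nat -> X) y :
  x @ U --> y -> N (x n) @[n --> U] --> N y.
Proof.
move=> xy; apply: (@lipschitz_cvg R _ _ X R^o N 2) => // u v.
have [_ NZ ND] := normN; apply: bounded_seminorm_lip => //.
by move=> z; have /andP[] := N2 z.
Qed.

(** Each free ultrafilter gives a limit. For two limits [y] and [z], taking the inner limit along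
    [V] and the outer one along [U] yields [N (y + z) = 2 * l], while [N y = N z = l]; so
    [renorming_eq] identifies them. *)
Lemma renorming_weakly_compact (x : nat -> X) (l : R) : relatively_weakly_compact x ->
  N (x n) @[n --> \oo] --> l -> iterated_lim (fun m n => N (x m + x n)) (2 * l) ->
  exists y : X, x n @[n --> \oo] --> y.
Proof.
move=> rwc Nl NNl; have [M M0 xM] := norm_bounded Nl.
have lge0 : 0 <= l.
  apply: ler_cvg_to (cvg_cst 0) Nl _; apply: nearW => n; exact: le_trans (leN _).
(* The identities need [0 < l]; for [l = 0] the sequence tends to 0 in norm. *)
have [le0|ln0] := eqVneq l 0.
  exists 0; apply/norm_cvg0P; rewrite le0 in Nl.
  apply: (squeeze_cvgr _ (cvg_cst 0) Nl).
  by apply: nearW => n; rewrite normr_ge0 leN.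
have l0 : 0 < l by rewrite lt_neqAle eq_sym ln0.
have cU (U : set_system nat) : UltraFilter U -> U `=>` \oo ->
    exists y : X, x @ U --> y.
  move=> FU Uoo; exists (lim (x @ U)).
  have := same_sign_identity (FU := FU) Uoo xM Nl l0 NNl.
  by move=> /(step_bound_asymptotic_norm xM)/(step_bound_cvg Uoo M0 xM); exact.
have [|U FU [Uoo _]] := exists_ultrafilter (A := setT).
  by move=> H; have [n []] := filter_ex H.
have [y xy] := cU U FU Uoo; exists y; apply: cvg_of_ultrafilters => V FV Voo.
have [z xz] := cU V FV Voo.
have lim_uniq (W : set_system nat) w : UltraFilter W -> W `=>` \oo -> x @ W --> w ->
    N w = l.
  move=> FW Woo xw; have h := N_cvg FW xw.
  by rewrite -(ulimE (cvg_ultra Woo Nl)) -(ulimE h).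
suff <- : z = y by [].
apply: renorming_eq; first by rewrite (lim_uniq V)// (lim_uniq U).
rewrite (lim_uniq V z)// (lim_uniq U y)//.
have [g gm gl] := NNl.
have gE m : g m = N (x m + z).
  have h : N (x m + x n) @[n --> V] --> N (x m + z).
    by apply: N_cvg; apply: cvgD => //; exact: cvg_cst.
  by rewrite -(ulimE (cvg_ultra Voo (gm m))) -(ulimE h).
have h : N (x m + z) @[m --> U] --> N (y + z).
  by apply: N_cvg; apply: cvgD => //; exact: cvg_cst.
have := ulimE (cvg_ultra Uoo gl); rewrite (funext gE) (ulimE h) addrC => ->.
by ring.
Qed.

Lemma renorming_l1 (x : nat -> X) (l : R) : 0 < l -> N (x n) @[n --> \oo] --> l ->
  iterated_lim (fun m n => N (x m + x n)) (2 * l) ->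
  iterated_lim (fun m n => N (x m - x n)) (2 * l) ->
  has_subsequence (@equivalent_to_l1_basis R X) x.
Proof.
move=> l0 Nl NNp NNm; have [M M0 xM] := norm_bounded Nl.
have [|U FU [Uoo _]] := exists_ultrafilter (A := setT).
  by move=> H; have [n []] := filter_ex H.
have s0 := asymptotic_norm_pos (FU := FU) Uoo xM Nl l0.
have Sp := same_sign_identity (FU := FU) Uoo xM Nl l0 NNp.
have Sm := opposite_sign_identity (FU := FU) Uoo xM Nl l0 NNm.
have [phi phii H] := l1_lower_estimate Uoo M0 xM s0
  (step_bound_symmetrized_norm xM Sp Sm).
exists phi => //; apply: (equivalent_to_l1_basisP M0 (divr_gt0 s0 (ltr0Sn R 1))) => //.
by move=> n; exact: xM.
Qed.

Lemma renorming_c0 (x : nat -> X) (l : R) : weakly_null x -> 0 < l ->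
  N (x n) @[n --> \oo] --> l -> iterated_lim (fun m n => N (x m + x n)) l ->
  has_subsequence (@equivalent_to_c0_basis R X) x.
Proof.
move=> wx l0 Nl NNl; have [M M0 xM] := norm_bounded Nl.
have [|U FU [Uoo _]] := exists_ultrafilter (A := setT).
  by move=> H; have [n []] := filter_ex H.
have s0 := asymptotic_norm_pos (FU := FU) Uoo xM Nl l0.
have x0 : (x : nat -> weak X) @ U --> (0 : weak X) by move=> A /wx/Uoo.
have S1 := weakly_null_identity (FU := FU) Uoo xM Nl l0 x0 NNl.
have [phi phii H] := c0_estimates Uoo M0 xM s0 (step_bound_norm xM x0)
  (step_bound_oppr_asymptotic_norm xM x0 S1)
  (fun v => norm_le_asymptotic_norm xM x0 v 1).
by exists phi => //; exact: equivalent_to_c0_basisP s0 H.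
Qed.

End Properties.

Unset Implicit Arguments.

Theorem mainTheorem1 (R : realType) (X : completeNormedModType R) :
  separable X ->
  exists N : X -> R,
    [/\ equivalent_norm N,
        strictly_convex N,
        (forall x : nat -> X,
          relatively_weakly_compact x ->
          (exists l : R,
            N (x n) @[n --> \oo] --> l /\
            iterated_lim (fun m n => N (x m + x n)) (2 * l)) ->
          exists y : X, x n @[n --> \oo] --> y),
        (forall x : nat -> X,
          (exists l : R,
            [/\ N (x n) @[n --> \oo] --> l,
                iterated_lim (fun m n => N (x m + x n)) (2 * l),
                iterated_lim (fun m n => N (x m - x n)) (2 * l)
              & 0 < 2 * l]) ->
          has_subsequence (@equivalent_to_l1_basis R X) x)
      & (forall x : nat -> X,
          weakly_null x ->
          (exists l : R,
            [/\ N (x n) @[n --> \oo] --> l,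
                iterated_lim (fun m n => N (x m + x n)) l
              & 0 < l]) ->
          has_subsequence (@equivalent_to_c0_basis R X) x)].
Proof.
move=> /exists_renorming[d [N [d0 dense_d normN N2 splitN]]].
exists N; split.
- exact: renorming_equivalent normN N2.
- exact: (renorming_strictly_convex d0 dense_d normN splitN).
- move=> x rwc [l [Nl NNl]].
  exact: (renorming_weakly_compact d0 dense_d normN N2 splitN rwc Nl NNl).
- move=> x [l [Nl NNp NNm l0]].
  have {}l0 : 0 < l by rewrite pmulr_rgt0 in l0.
  exact: (renorming_l1 d0 dense_d normN N2 splitN l0 Nl NNp NNm).
- move=> x wx [l [Nl NNl l0]].
  exact: (renorming_c0 d0 dense_d normN N2 splitN wx l0 Nl NNl).
Qed.
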